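(* Let $G$ be a $2$-connected $n$-vertex graph. For any $B\subseteq V(G)$ there exists a simple cycle in $G$ of length at least $\min\{n-|B|,\,2\delta(G-B)\}$. Moreover, there is a polynomial-time algorithm constructing a cycle of such length.
   Context: Graphs are finite, simple and undirected. For $X\subseteq V(G)$, $G-X$ is the subgraph induced by $V(G)\setminus X$; $\delta(H)$ is the minimum degree of $H$. The length of a cycle is its number of edges. *)

(* Defs.v *)
From mathcomp Require Import all_boot.

Set Implicit Arguments.
Unset Strict Implicit.
Unset Printing Implicit Defensive.

Record sgraph := SGraph {
  vertex :> finType;
  adj : rel vertex;
  adj_sym : symmetric adj;
  adj_irrefl : irreflexive adj }.

Section DeleteVertices.
Variables (G : sgraph) (X : {set G}).

Definition delete_adj : rel {x : G | x \notin X} :=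
  fun x y => adj (val x) (val y).

Lemma delete_adj_sym : symmetric delete_adj.
Proof. by move=> x y; apply: adj_sym. Qed.

Lemma delete_adj_irrefl : irreflexive delete_adj.
Proof. by move=> x; apply: adj_irrefl. Qed.

(* The graph G - X. *)
Definition delete : sgraph := SGraph delete_adj_sym delete_adj_irrefl.

End DeleteVertices.

Definition connected (G : sgraph) : Prop :=
  0 < #|G| /\ forall x y : G, connect (@adj G) x y.

Definition k_connected (k : nat) (G : sgraph) : Prop :=
  k < #|G| /\ forall X : {set G}, #|X| < k -> connected (delete X).

Definition degree (G : sgraph) (v : G) : nat := #|[set u : G | adj v u]|.

(* Every degree is less than #|G|, so the default value #|G| does not affect
   the minimum over a nonempty vertex set; the graph without vertices gets 0. *)
Definition min_degree (G : sgraph) : nat :=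
  \big[minn/#|G|]_(v : G) degree v.

(* A cycle is given by its vertices in cyclic order, so that its number of
   edges is the size of the sequence. *)
Definition is_cycle (G : sgraph) (C : seq G) : Prop :=
  ucycle (@adj G) C /\ 2 < size C.

(* Model of computation: a first-order, call-by-value functional language over
   binary trees (LISP cons cells), with general recursion and unit cost for
   every evaluation step.  Values are immutable and can be represented by
   pointers, and the length of an environment is bounded by a constant
   depending only on the program, so that each step takes constant time on a
   pointer machine; time in this model is polynomially related to time on
   Turing machines (see N. D. Jones, Computability and Complexity from a
   Programming Perspective, MIT Press 1997). *)
Inductive tree : Type := Leaf | Node of tree & tree.

(* Variables are de Bruijn indices.  ELet binds one variable in its second
   argument.  ECase e e0 e1 evaluates e0 if e is a leaf; otherwise it evaluates
   e1 with index 0 bound to the left and index 1 to the right subtree. *)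
Inductive exp : Type :=
| EVar of nat
| ELeaf
| ENode of exp & exp
| ELet of exp & exp
| ECase of exp & exp & exp
| ECall of nat & exp.

(* The i-th entry is the body of the function number i, whose unique argument
   is EVar 0; functions can be mutually recursive. *)
Definition program : Type := seq exp.

(* eval p env e v t: in the environment env, the expression e evaluates to v
   in exactly t steps. *)
Inductive eval (p : program) : seq tree -> exp -> tree -> nat -> Prop :=
| eval_var env i :
    eval p env (EVar i) (nth Leaf env i) 1
| eval_leaf env :
    eval p env ELeaf Leaf 1
| eval_node env e1 e2 v1 v2 t1 t2 :
    eval p env e1 v1 t1 -> eval p env e2 v2 t2 ->
    eval p env (ENode e1 e2) (Node v1 v2) (t1 + t2).+1
| eval_let env e1 e2 v1 v2 t1 t2 :
    eval p env e1 v1 t1 -> eval p (v1 :: env) e2 v2 t2 ->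
    eval p env (ELet e1 e2) v2 (t1 + t2).+1
| eval_case_leaf env e e0 e1 v t t0 :
    eval p env e Leaf t -> eval p env e0 v t0 ->
    eval p env (ECase e e0 e1) v (t + t0).+1
| eval_case_node env e e0 e1 l r v t t1 :
    eval p env e (Node l r) t -> eval p [:: l, r & env] e1 v t1 ->
    eval p env (ECase e e0 e1) v (t + t1).+1
| eval_call env f e u v t1 t2 :
    eval p env e u t1 -> eval p [:: u] (nth ELeaf p f) v t2 ->
    eval p env (ECall f e) v (t1 + t2).+1.

(* Execution starts with the function number 0. *)
Definition runs_in (p : program) (input output : tree) (t : nat) : Prop :=
  eval p [:: input] (nth ELeaf p 0) output t.

Definition enc_nat (n : nat) : tree := iter n (Node Leaf) Leaf.

Definition enc_bool (b : bool) : tree := if b then Node Leaf Leaf else Leaf.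

Definition enc_seq (A : Type) (enc : A -> tree) (s : seq A) : tree :=
  foldr (fun x => Node (enc x)) Leaf s.

(* The input is the adjacency matrix of G together with the characteristic
   vector of B, both with respect to the enumeration of the vertices of G;
   a vertex in the output is represented by its position in this enumeration,
   in unary.  The input has size between #|G| and a polynomial in #|G|, so
   polynomial time can be measured in terms of #|G|. *)
Definition enc_input (G : sgraph) (B : {set G}) : tree :=
  Node
    (enc_seq (enc_seq enc_bool)
       [seq [seq adj x y | y <- enum G] | x <- enum G])
    (enc_seq enc_bool [seq x \in B | x <- enum G]).

Definition enc_vertices (G : sgraph) (C : seq G) : tree :=
  enc_seq (fun x : G => enc_nat (enum_rank x)) C.

(* A partial specification: nothing is required of p on pairs (G, B) that
   violate pre.  Any polynomial in #|G| is bounded by some c * #|G|.+1 ^ k. *)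
Definition polytime_constructs
    (pre : forall G : sgraph, {set G} -> Prop)
    (post : forall G : sgraph, {set G} -> seq G -> Prop) (p : program) : Prop :=
  exists c k : nat, forall (G : sgraph) (B : {set G}), pre G B ->
    exists (C : seq G) (t : nat),
      [/\ runs_in p (enc_input B) (enc_vertices C) t,
          t <= c * #|G|.+1 ^ k & post G B C].

(* Main.v *)
Require Import Defs.
From mathcomp Require Import all_boot.
From mathcomp Require Import zify.

(* The cycle comes from a path P with both ends outside B that no simple move
   replaces by a path with more vertices outside B.  All neighbours outside B
   of the ends v0 and vm of P lie on P, so both ends have at least
   d = delta (G - B) neighbours on P, and a cycle through all of P must contain
   V \ B: a vertex outside B and off the cycle could be joined to it, and
   cutting the cycle open at the joint would give a better path.
   If some neighbour of vm precedes a neighbour of v0 on P, a closest such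
   pair gives a cycle through all of P or one of length at least 2 d.
   Otherwise let a be the last neighbour of v0.  The edge v0 a makes P a
   lollipop: a cycle through v0 and its neighbours together with the rest of P
   as a tail.  By 2-connectivity some ear joins the cycle to the tail avoiding
   the vertex where they meet, and rerouting along it shortens the tail while
   keeping v0 and its neighbours on the cycle.  As soon as the tail begins
   beyond the first neighbour of vm, closing up at vm gives a cycle through all
   neighbours of v0 and vm, which has length at least 2 d.
   Since every step is a search through polynomially many candidates, the
   argument is written as a function on adjacency matrices, and a calculus of
   polynomial-time functions compiles it to a program. *)

Set Implicit Arguments.
Unset Strict Implicit.
Unset Printing Implicit Defensive.

(** * Functions computed by programs in polynomial time *)

(** The obstacle is an ear that ends among the neighbours of [v0]: rerouting along it could cut some
    of them off the cycle. So the whole head [A] of [P], up to the last neighbour p a of [v0], is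
    kept in reserve. Apart from a core around [v0], the cycle of the lollipop avoids [A] and p a,
    and no ear has an interior vertex in [A], not even one that is off the cycle. If an ear ends at
    p i with i < a, the core is rebuilt from [P]: it runs from p a down to the first neighbour p r
    of [v0] beyond p i, takes the edge to [v0] and goes on to p i. Only the vertices strictly
    between p i and p r are lost, and none of them is a neighbour of [v0]. The bound 2 d comes from
    two disjoint families of positions. Without a crossing pair, p a is the only possible common
    neighbour of the ends, and vm itself makes up for it. For a closest crossing pair that is not
    consecutive on [P], the predecessors of the neighbours of [v0] are disjoint from the neighbours
    of vm. Paths are compared by their number of vertices outside B, so vertices of B may occur
    freely on paths and cycles. *)

Fixpoint tsize (t : tree) : nat :=
  if t is Node l r then (tsize l + tsize r).+1 else 1.

Lemma tsize_gt0 t : 0 < tsize t.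
Proof. by case: t. Qed.

(** Trees have positive size, and for positive [s] a monomial grows with its exponent, so a sum of
    two bounds is again below a single monomial. *)
Definition poly_bounded (b : nat -> nat) :=
  exists c k, forall s, 0 < s -> b s <= c * s ^ k.

Lemma poly_bounded_const m : poly_bounded (fun=> m).
Proof. by exists m, 0 => s _; rewrite expn0 muln1. Qed.

Lemma poly_bounded_id : poly_bounded id.
Proof. by exists 1, 1 => s _; rewrite mul1n. Qed.

Lemma poly_bounded_add f g :
  poly_bounded f -> poly_bounded g -> poly_bounded (fun s => f s + g s).
Proof.
move=> [c [k Hf]] [d [l Hg]]; exists (c + d), (k + l) => s s0.
rewrite mulnDl leq_add //.
  by apply: leq_trans (Hf _ s0) _; rewrite leq_mul2l leq_pexp2l ?leq_addr ?orbT.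
by apply: leq_trans (Hg _ s0) _; rewrite leq_mul2l leq_pexp2l ?leq_addl ?orbT.
Qed.

Lemma poly_bounded_mul f g :
  poly_bounded f -> poly_bounded g -> poly_bounded (fun s => f s * g s).
Proof.
move=> [c [k Hf]] [d [l Hg]]; exists (c * d), (k + l) => s s0.
by rewrite expnD mulnACA leq_mul ?Hf ?Hg.
Qed.

Lemma poly_bounded_exp f k :
  poly_bounded f -> poly_bounded (fun s => f s ^ k).
Proof.
move=> Hf; elim: k => [|k IH]; first exact: poly_bounded_const.
have [c [d H]] := poly_bounded_mul Hf IH.
by exists c, d => s s0; rewrite expnS H.
Qed.

Ltac polyb := repeat first
  [ apply: poly_bounded_add | apply: poly_bounded_mul | apply: poly_bounded_exp
  | exact: poly_bounded_const | exact: poly_bounded_id | assumption ].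

Lemma leq_monom c k m n : m <= n -> c * m ^ k <= c * n ^ k.
Proof.
move=> le_mn; rewrite leq_mul2l; apply/orP; right.
by case: k => [//|k]; rewrite leq_exp2r.
Qed.

(* Calls to a function beyond the end of the program return Leaf; they must keep
   doing so when the program becomes a part of a longer one. *)
Fixpoint relocate (n off : nat) (e : exp) : exp :=
  match e with
  | EVar i => EVar i
  | ELeaf => ELeaf
  | ENode e1 e2 => ENode (relocate n off e1) (relocate n off e2)
  | ELet e1 e2 => ELet (relocate n off e1) (relocate n off e2)
  | ECase e e0 e1 =>
      ECase (relocate n off e) (relocate n off e0) (relocate n off e1)
  | ECall f e => if f < n then ECall (f + off) (relocate n off e)
                 else ELet (relocate n off e) ELeaf
  end.

Lemma eval_relocate (p q : program) off :
  (forall i, i < size p ->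
     nth ELeaf q (i + off) = relocate (size p) off (nth ELeaf p i)) ->
  forall env e v t, eval p env e v t -> eval q env (relocate (size p) off e) v t.
Proof.
move=> Hq env e v t; elim=> /=; try by [econstructor | econstructor; eassumption].
move=> env' f e' u w t1 t2 _ IH1 E2 IH2; case: ltnP => [lt_f|ge_f].
  by econstructor; [exact: IH1 | rewrite Hq].
(* The missing function returned [Leaf] in one step; the [ELet] that replaces the call takes exactly
   as long. *)
rewrite nth_default // in E2 IH2; inversion E2; subst.
by econstructor; [exact: IH1 | constructor].
Qed.

(** * Encodings and programs that provide functions *)

Class Enc (A : Type) := enc : A -> tree.
#[global] Instance Enc_unit : Enc unit := fun=> Leaf.
#[global] Instance Enc_nat : Enc nat := enc_nat.
#[global] Instance Enc_bool : Enc bool := enc_bool.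
#[global] Instance Enc_seq A {EA : Enc A} : Enc (seq A) := enc_seq (@enc A EA).
#[global] Instance Enc_prod A B {EA : Enc A} {EB : Enc B} : Enc (A * B) :=
  fun x => Node (enc x.1) (enc x.2).

Definition esize A {EA : Enc A} (a : A) := tsize (enc a).

Lemma esize_pair A B {EA : Enc A} {EB : Enc B} (a : A) (b : B) :
  esize (a, b) = (esize a + esize b).+1.
Proof. by []. Qed.

Lemma esize_cons A {EA : Enc A} (x : A) s :
  esize (x :: s) = (esize x + esize s).+1.
Proof. by []. Qed.

Lemma esize_gt0 A {EA : Enc A} (a : A) : 0 < esize a.
Proof. exact: tsize_gt0. Qed.

Lemma size_esize A {EA : Enc A} (s : seq A) : size s < esize s.
Proof. by elim: s => // x s IH; rewrite esize_cons /=; lia. Qed.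

Lemma esize_cat A {EA : Enc A} (s1 s2 : seq A) :
  (esize (s1 ++ s2)).+1 = esize s1 + esize s2.
Proof. by elim: s1 => // x s IH; rewrite /= !esize_cons; lia. Qed.

(** The size of the result needs a bound of its own: values are shared, so the time does not bound
    it polynomially, while the cost of a composition depends on the size of the intermediate
    value. *)
Definition provides A B {EA : Enc A} {EB : Enc B} (q : program) i (f : A -> B) :=
  i < size q /\ exists c k, forall a, exists t,
  [/\ eval q [:: enc a] (nth ELeaf q i) (enc (f a)) t,
      t <= c * esize a ^ k & esize (f a) <= c * esize a ^ k].

Definition polytime A B {EA : Enc A} {EB : Enc B} (f : A -> B) :=
  exists q i, provides q i f.

(** The functions of [q] keep their numbers, so the new code [m] calls them directly and finds its
    own functions from number [size q] on. *)
Definition extend (q m : program) : program :=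
  [seq relocate (size q) 0 e | e <- q] ++ m.

Lemma provides_extend A B {EA : Enc A} {EB : Enc B} q m i (f : A -> B) :
  provides q i f -> provides (extend q m) i f.
Proof.
move=> [lt_i [c [k H]]]; split; first by rewrite size_cat size_map ltn_addr.
exists c, k => a; have [t [E le1 le2]] := H a; exists t; split=> //.
rewrite nth_cat size_map lt_i (nth_map ELeaf) //.
by apply: eval_relocate E => j lt_j; rewrite addn0 nth_cat size_map lt_j (nth_map ELeaf).
Qed.

Lemma nth_extend q m i : nth ELeaf (extend q m) (size q + i) = nth ELeaf m i.
Proof. by rewrite nth_cat size_map ltnNge leq_addr addKn. Qed.

Lemma size_extend q m : size (extend q m) = size q + size m.
Proof. by rewrite size_cat size_map. Qed.

Definition join (q1 q2 : program) : program :=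
  extend q1 [seq relocate (size q2) (size q1) e | e <- q2].

Lemma provides_joinl A B {EA : Enc A} {EB : Enc B} q1 q2 i (f : A -> B) :
  provides q1 i f -> provides (join q1 q2) i f.
Proof. exact: provides_extend. Qed.

Lemma provides_joinr A B {EA : Enc A} {EB : Enc B} q1 q2 i (f : A -> B) :
  provides q2 i f -> provides (join q1 q2) (size q1 + i) f.
Proof.
move=> [lt_i [c [k H]]]; split; first by rewrite size_extend size_map ltn_add2l.
exists c, k => a; have [t [E le1 le2]] := H a; exists t; split=> //.
rewrite nth_extend (nth_map ELeaf) //.
by apply: eval_relocate E => j lt_j; rewrite addnC nth_extend (nth_map ELeaf).
Qed.

(** * Closure properties of polynomial-time functions *)

Section Closure.
Context {A B C : Type} {EA : Enc A} {EB : Enc B} {EC : Enc C}.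

Lemma polytime_intro (f : A -> B) q m b1 b2 :
  poly_bounded b1 -> poly_bounded b2 ->
  0 < size m ->
  (forall a, exists t, eval (extend q m) [:: enc a] (nth ELeaf m 0) (enc (f a)) t
     /\ t <= b1 (esize a)) ->
  (forall a, esize (f a) <= b2 (esize a)) -> polytime f.
Proof.
move=> pb1 pb2 m0 H1 H2; exists (extend q m), (size q); split.
  by rewrite size_extend -[X in X < _]addn0 ltn_add2l.
have [c [k Hc]] := poly_bounded_add pb1 pb2; exists c, k => a.
have [t [E le_t]] := H1 a; exists t; rewrite -[size q]addn0 nth_extend.
have h := Hc _ (tsize_gt0 (@enc A EA a)); have h2 := H2 a; split=> //.
  exact: leq_trans le_t (leq_trans (leq_addr _ _) h).
exact: leq_trans h2 (leq_trans (leq_addl _ _) h).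
Qed.

Lemma polytime_eq (f g : A -> B) : f =1 g -> polytime f -> polytime g.
Proof.
move=> eq_fg [q [i [lt_i [c [k H]]]]]; exists q, i; split=> //.
by exists c, k => a; rewrite -eq_fg.
Qed.

(** Programs see only codes, so a change of type that preserves the code is free. *)
Lemma polytime_enc (f : A -> B) (g : A -> C) :
  (forall a, enc (f a) = enc (g a)) -> polytime f -> polytime g.
Proof.
move=> eq_fg [q [i [lt_i [c [k H]]]]]; exists q, i; split=> //.
by exists c, k => a; rewrite /esize -eq_fg.
Qed.

End Closure.

Lemma polytime_id A {EA : Enc A} : polytime (fun a : A => a).
Proof.
apply: (@polytime_intro _ _ _ _ _ [::] [:: EVar 0] (fun=> 1) id) => //; polyb.
by move=> a; exists 1; split=> //; exact: (eval_var _ [:: enc a] 0).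
Qed.

Fixpoint quote_tree (t : tree) : exp :=
  if t is Node l r then ENode (quote_tree l) (quote_tree r) else ELeaf.

Lemma eval_quote p env t : eval p env (quote_tree t) t (tsize t).
Proof. by elim: t => [|l IHl r IHr] /=; constructor. Qed.

Lemma polytime_const A B {EA : Enc A} {EB : Enc B} (b : B) :
  polytime (fun _ : A => b).
Proof.
apply: (@polytime_intro _ _ _ _ _ [::] [:: quote_tree (enc b)]
  (fun=> esize b) (fun=> esize b)) => //; polyb.
by move=> a; exists (esize b); split=> //; exact: eval_quote.
Qed.

Lemma eval_provided A B {EA : Enc A} {EB : Enc B} q i (f : A -> B) :
  provides q i f -> exists c k, forall a env e t, eval q env e (enc a) t ->
  esize (f a) <= c * esize a ^ k /\
  exists2 t', eval q env (ECall i e) (enc (f a)) t' & t' <= t + c * esize a ^ k + 1.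
Proof.
move=> [_ [c [k H]]]; exists c, k => a env e t E.
have [t' [E' le_t' le_s]] := H a; split=> //.
by exists (t + t').+1; [exact: eval_call E E' | lia].
Qed.

Ltac evs := first [ exact: eval_leaf | match goal with
  | |- eval _ _ (EVar ?i) _ _ => refine (eval_var _ _ i) end ].

Lemma polytime_comp A B C {EA : Enc A} {EB : Enc B} {EC : Enc C}
    (g : B -> C) (f : A -> B) :
  polytime g -> polytime f -> polytime (fun a => g (f a)).
Proof.
move=> [q1 [i1 P1]] [q2 [i2 P2]].
pose m := [:: ECall i1 (ECall (size q1 + i2) (EVar 0))].
have [cg [kg Hg]] := eval_provided (provides_extend m (provides_joinl q2 P1)).
have [cf [kf Hf]] := eval_provided (provides_extend m (provides_joinr q1 P2)).
pose bs s := cf * s ^ kf.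
apply: (@polytime_intro _ _ _ _ _ (join q1 q2) m
  (fun s => 1 + bs s + 1 + cg * bs s ^ kg + 1) (fun s => cg * bs s ^ kg)) => //; rewrite /bs; polyb.
  move=> a; have [le1 [t1 E1 le_t1]] := Hf a [:: enc a] _ _ (eval_var _ [:: enc a] 0).
  have [le2 [t2 E2 le_t2]] := Hg _ _ _ _ E1; exists t2; split=> //.
  by apply: leq_trans le_t2 _; rewrite !leq_add2r leq_add // leq_monom.
move=> a; have [le1 _] := Hf a [:: enc a] _ _ (eval_var _ [:: enc a] 0).
have [le2 _] := Hg _ [:: enc (f a)] _ _ (eval_var _ [:: enc (f a)] 0).
by apply: leq_trans le2 _; rewrite leq_monom.
Qed.

Lemma polytime_pair A B C {EA : Enc A} {EB : Enc B} {EC : Enc C}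
    (f : A -> B) (g : A -> C) :
  polytime f -> polytime g -> polytime (fun a => (f a, g a)).
Proof.
move=> [q1 [i1 P1]] [q2 [i2 P2]].
pose m := [:: ENode (ECall i1 (EVar 0)) (ECall (size q1 + i2) (EVar 0))].
have [cf [kf Hf]] := eval_provided (provides_extend m (provides_joinl q2 P1)).
have [cg [kg Hg]] := eval_provided (provides_extend m (provides_joinr q1 P2)).
apply: (@polytime_intro _ _ _ _ _ (join q1 q2) m
  (fun s => cf * s ^ kf + cg * s ^ kg + 5) (fun s => cf * s ^ kf + cg * s ^ kg + 1)) => //; polyb.
  move=> a; have [le1 [t1 E1 le_t1]] := Hf a [:: enc a] _ _ (eval_var _ [:: enc a] 0).
  have [le2 [t2 E2 le_t2]] := Hg a [:: enc a] _ _ (eval_var _ [:: enc a] 0).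
  by exists (t1 + t2).+1; split; [exact: eval_node E1 E2 | rewrite /=; lia].
move=> a; have [le1 _] := Hf a [:: enc a] _ _ (eval_var _ [:: enc a] 0).
have [le2 _] := Hg a [:: enc a] _ _ (eval_var _ [:: enc a] 0).
rewrite esize_pair /=; lia.
Qed.

Lemma polytime_fst_prim A B {EA : Enc A} {EB : Enc B} : polytime (@fst A B).
Proof.
apply: (@polytime_intro _ _ _ _ _ [::] [:: ECase (EVar 0) ELeaf (EVar 0)]
  (fun=> 3) id) => //; polyb.
  case=> a b; exists (1 + 1).+1; split=> //.
  by refine (eval_case_node (l := enc a) (r := enc b) _ (eval_var _ [:: _] 0) _); evs.
by case=> a b; rewrite /esize /=; lia.
Qed.

Lemma polytime_snd_prim A B {EA : Enc A} {EB : Enc B} : polytime (@snd A B).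
Proof.
apply: (@polytime_intro _ _ _ _ _ [::] [:: ECase (EVar 0) ELeaf (EVar 1)]
  (fun=> 3) id) => //; polyb.
  case=> a b; exists (1 + 1).+1; split=> //.
  by refine (eval_case_node (l := enc a) (r := enc b) _ (eval_var _ [:: _] 0) _);
     exact: (eval_var _ [:: _; _; _] 1).
by case=> a b; rewrite /esize /=; lia.
Qed.

Lemma polytime_if A B {EA : Enc A} {EB : Enc B} (c : A -> bool) (f g : A -> B) :
  polytime c -> polytime f -> polytime g ->
  polytime (fun a => if c a then f a else g a).
Proof.
move=> [q1 [i1 P1]] [q2 [i2 P2]] [q3 [i3 P3]].
pose q := join q1 (join q2 q3).
(* The code of [true] is a node, whose two subtrees take the indices 0 and 1; in that branch the
   argument has index 2. *)
pose m := [:: ECase (ECall i1 (EVar 0))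
                (ECall (size q1 + (size q2 + i3)) (EVar 0))
                (ECall (size q1 + i2) (EVar 2))].
have [c1 [k1 H1]] := eval_provided (provides_extend m (provides_joinl (join q2 q3) P1)).
have [c2 [k2 H2]] := eval_provided
  (provides_extend m (provides_joinr q1 (provides_joinl q3 P2))).
have [c3 [k3 H3]] := eval_provided
  (provides_extend m (provides_joinr q1 (provides_joinr q2 P3))).
apply: (@polytime_intro _ _ _ _ _ q m
  (fun s => c1 * s ^ k1 + c2 * s ^ k2 + c3 * s ^ k3 + 10)
  (fun s => c2 * s ^ k2 + c3 * s ^ k3)) => //; polyb.
  move=> a; have [_ [t1 E1 le_t1]] := H1 a [:: enc a] _ _ (eval_var _ [:: enc a] 0).
  case: (c a) E1 => E1.
    have [_ [t2 E2 le_t2]] := H2 a [:: Leaf; Leaf; enc a] _ _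
      (eval_var _ [:: Leaf; Leaf; enc a] 2).
    by exists (t1 + t2).+1; split; [exact: eval_case_node _ E1 E2 | rewrite /=; lia].
  have [_ [t2 E2 le_t2]] := H3 a [:: enc a] _ _ (eval_var _ [:: enc a] 0).
  by exists (t1 + t2).+1; split; [exact: eval_case_leaf _ E1 E2 | rewrite /=; lia].
move=> a; have [le2 _] := H2 a [:: enc a] _ _ (eval_var _ [:: enc a] 0).
have [le3 _] := H3 a [:: enc a] _ _ (eval_var _ [:: enc a] 0).
case: (c a); lia.
Qed.

Lemma polytime_behead_prim A {EA : Enc A} : polytime (@behead A).
Proof.
apply: (@polytime_intro _ _ _ _ _ [::] [:: ECase (EVar 0) ELeaf (EVar 1)]
  (fun=> 3) id) => //; polyb.
  case=> [|x s]; exists (1 + 1).+1; split=> //.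
    by refine (eval_case_leaf _ (eval_var _ [:: Leaf] 0) _); evs.
  refine (eval_case_node (l := enc x) (r := enc s) _ (eval_var _ [:: _] 0) _).
  exact: (eval_var _ [:: _; _; _] 1).
by case=> [|x s] //; rewrite /= ?esize_cons; lia.
Qed.

Lemma polytime_head_prim A {EA : Enc A} (d : A) :
  enc d = Leaf -> polytime (@head A d).
Proof.
move=> dE.
apply: (@polytime_intro _ _ _ _ _ [::] [:: ECase (EVar 0) ELeaf (EVar 0)]
  (fun=> 3) id) => //; polyb.
  case=> [|x s]; exists (1 + 1).+1; split=> //=.
    by rewrite dE; refine (eval_case_leaf _ (eval_var _ [:: Leaf] 0) _); evs.
  refine (eval_case_node (l := enc x) (r := enc s) _ (eval_var _ [:: _] 0) _).
  exact: (eval_var _ [:: _; _; _] 0).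
by case=> [|x s]; [rewrite /esize /= dE | rewrite /= ?esize_cons; lia].
Qed.

Lemma polytime_nilp_prim A {EA : Enc A} : polytime (@nilp A).
Proof.
apply: (@polytime_intro _ _ _ _ _ [::]
  [:: ECase (EVar 0) (ENode ELeaf ELeaf) ELeaf] (fun=> 5) (fun=> 3)) => //; polyb.
  case=> [|x s].
    exists (1 + 3).+1; split=> //; refine (eval_case_leaf _ (eval_var _ [:: Leaf] 0) _).
    exact: (eval_quote _ _ (Node Leaf Leaf)).
  exists (1 + 1).+1; split=> //; refine (eval_case_node (l := enc x) (r := enc s) _ (eval_var _ [:: _] 0) _).
  exact: eval_leaf.
by case.
Qed.

(* Values share subtrees, so without the bound on the intermediate results their
   size could be exponential in the number of steps. *)
Lemma polytime_foldr A X R {EA : Enc A} {EX : Enc X} {ER : Enc R}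
    (l : A -> seq X) (z : A -> R) (h : X -> R -> A -> R) b :
  poly_bounded b ->
  (forall a s1 s2, l a = s1 ++ s2 ->
     esize (foldr (fun x r => h x r a) (z a) s2) <= b (esize a)) ->
  polytime l -> polytime z -> polytime (fun q => h q.1.1 q.1.2 q.2) ->
  polytime (fun a => foldr (fun x r => h x r a) (z a) (l a)).
Proof.
move=> pb_b Hb [q1 [i1 P1]] [q2 [i2 P2]] [q3 [i3 P3]].
pose q := join q1 (join q2 q3); pose L := (size q).+1; have LE : L = size q + 1 by rewrite addn1.
(* Function [L] is the loop on a pair of a list and [a]. Inside its second [ECase] the indices 0 to
   4 stand for the first entry, the remaining list, the whole list, [a] and the pair. *)
pose m := [:: ECall L (ENode (ECall i1 (EVar 0)) (EVar 0));
  ECase (EVar 0) ELeaf (ECase (EVar 0) (ECall (size q1 + i2) (EVar 1))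
   (ECall (size q1 + (size q2 + i3))
      (ENode (ENode (EVar 0) (ECall L (ENode (EVar 1) (EVar 3)))) (EVar 3))))].
have [c1 [k1 H1]] := eval_provided (provides_extend m (provides_joinl (join q2 q3) P1)).
have [c2 [k2 H2]] := eval_provided
  (provides_extend m (provides_joinr q1 (provides_joinl q3 P2))).
have [c3 [k3 H3]] := eval_provided
  (provides_extend m (provides_joinr q1 (provides_joinr q2 P3))).
pose bl s := c1 * s ^ k1.
(* The cost of one call of [h]: its argument consists of an entry of the list, a partial result and
   [a], of sizes at most [bl s], [b s] and [s], under two pair nodes. *)
pose bh s := c3 * (bl s + b s + s + 2) ^ k3.
apply: (@polytime_intro _ _ _ _ _ q m
  (fun s => bl s + (bl s * (bh s + 20) + (c2 * s ^ k2 + 20)) + 20) b) => //;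
  rewrite /bh /bl; polyb; last by move=> a; apply: (Hb a [::]).
move=> a; have [le_l [t1 E1 le_t1]] := H1 a [:: enc a] _ _ (eval_var _ [:: enc a] 0).
have loop s1 s2 : l a = s1 ++ s2 -> exists2 t,
    eval (extend q m) [:: Node (enc s2) (enc a)] (nth ELeaf m 1)
     (enc (foldr (fun x r => h x r a) (z a) s2)) t
    & t <= size s2 * (bh (esize a) + 20) + (c2 * esize a ^ k2 + 20).
  elim: s2 s1 => [|x s2 IH] s1 def_l.
    have [_ [t2 E2 le_t2]] := H2 a [:: Leaf; enc a; Node Leaf (enc a)] _ _
      (eval_var _ [:: Leaf; enc a; Node Leaf (enc a)] 1).
    exists (1 + (1 + t2).+1).+1; last by lia.
    apply: (eval_case_node _ (eval_var _ [:: Node Leaf (enc a)] 0)).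
    exact: (eval_case_leaf _ (eval_var _ [:: Leaf; enc a; _] 0)).
  have def_l' : l a = rcons s1 x ++ s2 by rewrite cat_rcons.
  have [t2 E2 le_t2] := IH _ def_l'.
  set r := foldr _ _ s2 in E2.
  pose (env := [:: enc x; enc s2; enc (x :: s2); enc a; Node (enc (x :: s2)) (enc a)]).
  have EL : eval (extend q m) env (ECall L (ENode (EVar 1) (EVar 3))) (enc r) (3 + t2).+1.
    apply: eval_call; first by apply: (eval_node (eval_var _ env 1) (eval_var _ env 3)).
    by rewrite LE nth_extend.
  have EN : eval (extend q m) env
      (ENode (ENode (EVar 0) (ECall L (ENode (EVar 1) (EVar 3)))) (EVar 3))
      (enc ((x, r), a)) ((1 + (3 + t2).+1).+1 + 1).+1.
    apply: eval_node; last exact: (eval_var _ env 3).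
    by apply: eval_node EL; exact: (eval_var _ env 0).
  have [_ [t3 E3 le_t3]] := H3 (x, r, a) _ _ _ EN.
  exists (1 + (1 + t3).+1).+1.
    apply: (eval_case_node _ (eval_var _ [:: Node (enc (x :: s2)) (enc a)] 0)).
    exact: (eval_case_node _ (eval_var _ [:: enc (x :: s2); enc a; _] 0) E3).
  have le_h : c3 * esize (x, r, a) ^ k3 <= bh (esize a).
    apply: leq_monom; rewrite !esize_pair.
    have := Hb a (rcons s1 x) s2 def_l'; rewrite -/r.
    have : esize x <= esize (l a).
      by rewrite def_l -ltnS esize_cat esize_cons; have := esize_gt0 s2; lia.
    rewrite /bl; lia.
  rewrite /=; lia.
have [t2 E2 le_t2] := loop [::] (l a) erefl.
exists ((t1 + 1).+1 + t2).+1; split.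
  apply: eval_call; first by apply: eval_node E1 _; exact: (eval_var _ [:: _] 0).
  by rewrite LE nth_extend.
have le_sz : size (l a) <= bl (esize a).
  by apply: leq_trans le_l; exact/ltnW/size_esize.
have le_m : size (l a) * (bh (esize a) + 20) <= bl (esize a) * (bh (esize a) + 20).
  by rewrite leq_mul2r le_sz orbT.
rewrite -/(bl _) in le_t1.
have le_sum : ((t1 + 1).+1 + t2).+1 <=
  bl (esize a) + (bl (esize a) * (bh (esize a) + 20) + (c2 * esize a ^ k2 + 20)) + 20.
  by lia.
exact: le_sum.
Qed.

Lemma polytime_size_bound A B {EA : Enc A} {EB : Enc B} (f : A -> B) :
  polytime f -> exists c k, forall a, esize (f a) <= c * esize a ^ k.
Proof.
move=> [q [i [_ [c [k H]]]]]; exists c, k => a.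
by have [t []] := H a.
Qed.

Lemma polytime_fst A B C {EA : Enc A} {EB : Enc B} {EC : Enc C} (f : A -> B * C) :
  polytime f -> polytime (fun a => (f a).1).
Proof. exact/polytime_comp/polytime_fst_prim. Qed.

Lemma polytime_snd A B C {EA : Enc A} {EB : Enc B} {EC : Enc C} (f : A -> B * C) :
  polytime f -> polytime (fun a => (f a).2).
Proof. exact/polytime_comp/polytime_snd_prim. Qed.

Lemma polytime_behead A B {EA : Enc A} {EB : Enc B} (f : A -> seq B) :
  polytime f -> polytime (fun a => behead (f a)).
Proof. exact/polytime_comp/polytime_behead_prim. Qed.

Lemma polytime_nilp A B {EA : Enc A} {EB : Enc B} (f : A -> seq B) :
  polytime f -> polytime (fun a => nilp (f a)).
Proof. exact/polytime_comp/polytime_nilp_prim. Qed.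

Lemma polytime_head A B {EA : Enc A} {EB : Enc B} d (f : A -> seq B) : enc d = Leaf ->
  polytime f -> polytime (fun a => head d (f a)).
Proof. by move=> dE; apply/polytime_comp/polytime_head_prim. Qed.

Lemma polytime_cons A B {EA : Enc A} {EB : Enc B} (f : A -> B) (g : A -> seq B) :
  polytime f -> polytime g -> polytime (fun a => f a :: g a).
Proof.
move=> Hf Hg.
by apply: (polytime_enc (f := fun a => (f a, g a))) => //; apply: polytime_pair.
Qed.

Lemma polytime_negb A {EA : Enc A} (f : A -> bool) :
  polytime f -> polytime (fun a => ~~ f a).
Proof.
move=> Hf; apply: (polytime_eq (f := fun a => if f a then false else true)) => [a|].
  by case: (f a).
by apply: polytime_if => //; apply: polytime_const.
Qed.

Lemma polytime_andb A {EA : Enc A} (f g : A -> bool) :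
  polytime f -> polytime g -> polytime (fun a => f a && g a).
Proof.
move=> Hf Hg; apply: (polytime_eq (f := fun a => if f a then g a else false)) => [a|].
  by case: (f a).
by apply: polytime_if => //; apply: polytime_const.
Qed.

Lemma polytime_orb A {EA : Enc A} (f g : A -> bool) :
  polytime f -> polytime g -> polytime (fun a => f a || g a).
Proof.
move=> Hf Hg; apply: (polytime_eq (f := fun a => if f a then true else g a)) => [a|].
  by case: (f a).
by apply: polytime_if => //; apply: polytime_const.
Qed.

(** A unary number has the same code as a list of units, so arithmetic reduces to list functions by
    [polytime_enc]. *)
Lemma enc_nseq_unit n : enc (nseq n tt) = enc n.
Proof. by elim: n => // n IH; rewrite -[RHS]/(Node Leaf (enc n)) -IH. Qed.

Lemma polytime_succn A {EA : Enc A} (f : A -> nat) :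
  polytime f -> polytime (fun a => (f a).+1).
Proof.
move=> Hf; refine (polytime_enc (f := fun a => (tt, f a)) _ _) => //.
by apply: polytime_pair => //; apply: polytime_const.
Qed.

Lemma polytime_nseq_unit A {EA : Enc A} (f : A -> nat) :
  polytime f -> polytime (fun a => nseq (f a) tt).
Proof. by move=> Hf; apply: polytime_enc Hf => a; rewrite enc_nseq_unit. Qed.

Lemma polytime_predn A {EA : Enc A} (f : A -> nat) :
  polytime f -> polytime (fun a => (f a).-1).
Proof.
move=> Hf; refine (polytime_enc (f := fun a => behead (nseq (f a) tt)) _ _) => [a|].
  by rewrite -enc_nseq_unit; case: (f a).
exact/polytime_behead/polytime_nseq_unit.
Qed.

Lemma polytime_eq0 A {EA : Enc A} (f : A -> nat) :
  polytime f -> polytime (fun a => f a == 0).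
Proof.
move=> Hf; apply: (polytime_eq (f := fun a => nilp (nseq (f a) tt))) => [a|].
  by case: (f a).
exact/polytime_nilp/polytime_nseq_unit.
Qed.

Ltac pt_base := first
  [ assumption
  | simple eapply polytime_id
  | simple eapply polytime_const
  | simple eapply polytime_fst
  | simple eapply polytime_snd
  | simple eapply polytime_pair
  | simple eapply polytime_behead
  | simple eapply polytime_nilp
  | simple eapply polytime_cons
  | simple eapply polytime_negb
  | simple eapply polytime_andb
  | simple eapply polytime_orb
  | simple eapply polytime_eq0
  | simple eapply polytime_if
  | simple eapply polytime_succn
  | simple eapply polytime_predn ].

(** An iteration is a fold over a list of [n a] units, so the size bound concerns just the iterates
    up to [n a]. *)
Lemma polytime_iter A B {EA : Enc A} {EB : Enc B} (n : A -> nat) (z : A -> B) (h : B -> A -> B) b :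
  poly_bounded b ->
  (forall a k, k <= n a ->
     esize (iter k (fun r => h r a) (z a)) <= b (esize a)) ->
  polytime n -> polytime z -> polytime (fun q => h q.1 q.2) ->
  polytime (fun a => iter (n a) (fun r => h r a) (z a)).
Proof.
move=> pb Hb Hn Hz Hh.
have iterE a k : foldr (fun _ r => h r a) (z a) (nseq k tt) =
    iter k (fun r => h r a) (z a) by elim: k => //= k ->.
apply: (polytime_eq (fun a => iterE a (n a))).
apply: (polytime_foldr (h := fun _ r a => h r a) pb) => //.
- move=> a s1 s2 def_n; have s2E : s2 = nseq (size s2) tt.
    by elim: (s2) => //= -[] s <-.
  rewrite s2E iterE; apply: Hb.
  by rewrite -(size_nseq (n a) tt) def_n size_cat leq_addl.
- exact: polytime_nseq_unit.
apply: (polytime_comp (g := fun q => h q.1 q.2) (f := fun q => (q.1.2, q.2))) => //.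
by repeat pt_base.
Qed.

Lemma polytime_cat A B {EA : Enc A} {EB : Enc B} (f g : A -> seq B) :
  polytime f -> polytime g -> polytime (fun a => f a ++ g a).
Proof.
move=> Hf Hg.
have [cf [kf Hcf]] := polytime_size_bound Hf.
have [cg [kg Hcg]] := polytime_size_bound Hg.
have catE a : foldr (fun x r => x :: r) (g a) (f a) = f a ++ g a.
  by elim: (f a) => //= x s ->.
apply: (polytime_eq catE).
apply: (polytime_foldr (h := fun x r _ => x :: r)
  (b := fun s => cf * s ^ kf + cg * s ^ kg)) => //; first by polyb.
- move=> a s1 s2 def_f; pose proof (esize_cat s1 s2) as E; rewrite -def_f in E.
  have -> : foldr (fun x r => x :: r) (g a) s2 = s2 ++ g a by elim: (s2) => //= x s ->.
  pose proof (esize_cat s2 (g a)).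
  by have := Hcf a; have := Hcg a; pose proof (esize_gt0 s1); lia.
- by repeat pt_base.
Qed.

Lemma polytime_rcons A B {EA : Enc A} {EB : Enc B} (f : A -> seq B) (g : A -> B) :
  polytime f -> polytime g -> polytime (fun a => rcons (f a) (g a)).
Proof.
move=> Hf Hg; apply: (polytime_eq (fun a => cats1 (f a) (g a))).
by apply: polytime_cat => //; repeat pt_base.
Qed.

Lemma esize_rev B {EB : Enc B} (s : seq B) : esize (rev s) = esize s.
Proof.
elim: s => // x s IH; rewrite rev_cons -cats1.
pose proof (esize_cat (rev s) [:: x]) as E; rewrite IH !esize_cons in E *.
have e1 : esize ([::] : seq B) = 1 by [].
by lia.
Qed.

Lemma polytime_rev A B {EA : Enc A} {EB : Enc B} (f : A -> seq B) :
  polytime f -> polytime (fun a => rev (f a)).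
Proof.
move=> Hf; have [cf [kf Hcf]] := polytime_size_bound Hf.
have revE (s : seq B) : foldr (fun x r => rcons r x) [::] s = rev s.
  by elim: s => //= x s ->; rewrite rev_cons.
apply: (polytime_eq (fun a => revE (f a))).
apply: (polytime_foldr (h := fun x r _ => rcons r x)
  (b := fun s => cf * s ^ kf)) => //; first by polyb.
- move=> a s1 s2 def_f; pose proof (esize_cat s1 s2) as E; rewrite -def_f in E; rewrite revE esize_rev.
  by have := Hcf a; pose proof (esize_gt0 s1); lia.
- by repeat pt_base.
- by apply: polytime_rcons; repeat pt_base.
Qed.

Lemma esize_suffix B {EB : Enc B} (s1 s2 : seq B) : esize s2 <= esize (s1 ++ s2).
Proof. by pose proof (esize_cat s1 s2); pose proof (esize_gt0 s1); lia. Qed.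

Lemma polytime_map A B C {EA : Enc A} {EB : Enc B} {EC : Enc C} (h : B -> A -> C) (l : A -> seq B) :
  polytime l -> polytime (fun q => h q.1 q.2) ->
  polytime (fun a => [seq h x a | x <- l a]).
Proof.
move=> Hl Hh; have [cl [kl Hcl]] := polytime_size_bound Hl.
have [ch [kh Hch]] := polytime_size_bound Hh.
apply: (polytime_foldr (h := fun x r a => h x a :: r)
  (b := fun s => cl * s ^ kl * (ch * (cl * s ^ kl + s + 1) ^ kh + 1) + 1)) => //;
  first by polyb.
- move=> a s1 s2 def_l.
  set M := ch * _ ^ kh.
  have le_s2 : esize s2 <= cl * esize a ^ kl.
    by apply: leq_trans (Hcl a); rewrite def_l esize_suffix.
  have le_M : esize (foldr (fun x r => h x a :: r) [::] s2) <= size s2 * (M + 1) + 1.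
    elim: s2 s1 def_l le_s2 => // x s2 IH s1 def_l; rewrite esize_cons => le_s2 /=.
    rewrite esize_cons.
    have le1 : esize (h x a) <= M.
      apply: leq_trans (Hch (x, a)) _; apply: leq_monom; rewrite esize_pair; lia.
    have := IH (rcons s1 x); rewrite cat_rcons => /(_ def_l).
    by lia.
  apply: leq_trans le_M _; rewrite leq_add2r leq_mul2r; apply/orP; right.
  by apply: leq_trans le_s2; apply/ltnW/size_esize.
- by repeat pt_base.
- apply: polytime_cons; last by repeat pt_base.
  by apply: (polytime_comp (g := fun q => h q.1 q.2) (f := fun q => (q.1.1, q.2))) => //;
    repeat pt_base.
Qed.

Lemma polytime_filter A B {EA : Enc A} {EB : Enc B} (h : B -> A -> bool) (l : A -> seq B) :
  polytime l -> polytime (fun q => h q.1 q.2) ->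
  polytime (fun a => [seq x <- l a | h x a]).
Proof.
move=> Hl Hh; have [cl [kl Hcl]] := polytime_size_bound Hl.
apply: (polytime_eq (f := fun a => foldr (fun x r => if h x a then x :: r else r) [::] (l a))).
  by move=> a; elim: (l a) => //= x s ->.
apply: (polytime_foldr (h := fun x r a => if h x a then x :: r else r)
  (b := fun s => cl * s ^ kl)) => //; first by polyb.
- move=> a s1 s2 def_l; apply: leq_trans (Hcl a); rewrite def_l.
  apply: leq_trans (esize_suffix s1 s2).
  elim: (s2) => //= x s IH; case: ifP; rewrite !esize_cons; lia.
- by repeat pt_base.
- apply: polytime_if; last by repeat pt_base.
    by apply: (polytime_comp (g := fun q => h q.1 q.2) (f := fun q => (q.1.1, q.2))) => //;
      repeat pt_base.
  by repeat pt_base.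
Qed.

Lemma polytime_has A B {EA : Enc A} {EB : Enc B} (h : B -> A -> bool) (l : A -> seq B) :
  polytime l -> polytime (fun q => h q.1 q.2) ->
  polytime (fun a => has (fun x => h x a) (l a)).
Proof.
move=> Hl Hh; apply: (polytime_eq (f := fun a => ~~ nilp [seq x <- l a | h x a])).
  by move=> a /=; rewrite has_count -size_filter lt0n.
by apply/polytime_negb/polytime_nilp/polytime_filter.
Qed.

Lemma polytime_all A B {EA : Enc A} {EB : Enc B} (h : B -> A -> bool) (l : A -> seq B) :
  polytime l -> polytime (fun q => h q.1 q.2) ->
  polytime (fun a => all (fun x => h x a) (l a)).
Proof.
move=> Hl Hh; apply: (polytime_eq (f := fun a => ~~ has (fun x => ~~ h x a) (l a))).
  by move=> a /=; rewrite -all_predC; apply: eq_all => x /=; rewrite negbK.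
by apply/polytime_negb/(polytime_has (h := fun x a => ~~ h x a)) => //; apply/polytime_negb.
Qed.

Lemma polytime_flatten A B {EA : Enc A} {EB : Enc B} (l : A -> seq (seq B)) :
  polytime l -> polytime (fun a => flatten (l a)).
Proof.
move=> Hl; have [cl [kl Hcl]] := polytime_size_bound Hl.
apply: (polytime_foldr (h := fun x r a => x ++ r)
  (b := fun s => cl * s ^ kl)) => //; first by polyb.
- move=> a s1 s2 def_l; apply: leq_trans (Hcl a); rewrite def_l.
  apply: leq_trans (esize_suffix s1 s2).
  elim: (s2) => [|x s IH]; rewrite ?esize_cons //=.
  move: IH; set r := foldr _ _ s => IH.
  pose proof (esize_cat x r); lia.
- by repeat pt_base.
- by apply: polytime_cat; repeat pt_base.
Qed.

Lemma polytime_size A B {EA : Enc A} {EB : Enc B} (l : A -> seq B) :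
  polytime l -> polytime (fun a => size (l a)).
Proof.
move=> Hl; refine (polytime_enc (f := fun a => [seq tt | x <- l a]) _ _).
  by move=> a /=; rewrite -enc_nseq_unit; elim: (l a) => //= x s IH; rewrite /enc /= in IH *; rewrite IH.
by apply: (polytime_map (h := fun _ _ => tt)) => //; repeat pt_base.
Qed.

Lemma polytime_drop A B {EA : Enc A} {EB : Enc B} (n : A -> nat) (l : A -> seq B) :
  polytime n -> polytime l -> polytime (fun a => drop (n a) (l a)).
Proof.
move=> Hn Hl; have [cl [kl Hcl]] := polytime_size_bound Hl.
have dropE k s : iter k (@behead B) s = drop k s.
  by elim: k => [|k IH]; rewrite ?drop0 //= IH -drop1 drop_drop.
apply: (polytime_eq (fun a => dropE (n a) (l a))).
apply: (polytime_iter (h := fun r a => behead r) (b := fun s => cl * s ^ kl)) => //;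
  first by polyb.
- move=> a k _; rewrite dropE; apply: leq_trans (Hcl a).
  by rewrite -{2}(cat_take_drop k (l a)) esize_suffix.
- by repeat pt_base.
Qed.

Lemma polytime_nth A B {EA : Enc A} {EB : Enc B} d (n : A -> nat) (l : A -> seq B) : enc d = Leaf ->
  polytime n -> polytime l -> polytime (fun a => nth d (l a) (n a)).
Proof.
move=> dE Hn Hl; apply: (polytime_eq (f := fun a => head d (drop (n a) (l a)))).
  by move=> a /=; rewrite -nth0 nth_drop addn0.
exact/polytime_head/polytime_drop.
Qed.

Lemma polytime_last A B {EA : Enc A} {EB : Enc B} d (l : A -> seq B) : enc d = Leaf ->
  polytime l -> polytime (fun a => last d (l a)).
Proof.
move=> dE Hl; apply: (polytime_eq (f := fun a => head d (rev (l a)))).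
  by move=> a; case/lastP: (l a) => [|s x] //; rewrite rev_rcons last_rcons.
exact/polytime_head/polytime_rev.
Qed.

Lemma polytime_subn A {EA : Enc A} (m n : A -> nat) :
  polytime m -> polytime n -> polytime (fun a => m a - n a).
Proof.
move=> Hm Hn; apply: (polytime_eq (f := fun a => size (drop (n a) (nseq (m a) tt)))).
  by move=> a /=; rewrite size_drop size_nseq.
by apply/polytime_size/polytime_drop => //; apply: polytime_nseq_unit.
Qed.

Lemma polytime_leq A {EA : Enc A} (m n : A -> nat) :
  polytime m -> polytime n -> polytime (fun a => m a <= n a).
Proof. by move=> Hm Hn; apply/polytime_eq0/polytime_subn. Qed.

Lemma polytime_eqn A {EA : Enc A} (m n : A -> nat) :
  polytime m -> polytime n -> polytime (fun a => m a == n a).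
Proof.
move=> Hm Hn; apply: (polytime_eq (f := fun a => (m a <= n a) && (n a <= m a))).
  by move=> a /=; rewrite eqn_leq.
by apply: polytime_andb; apply: polytime_leq.
Qed.

Lemma polytime_take A B {EA : Enc A} {EB : Enc B} (n : A -> nat) (l : A -> seq B) :
  polytime n -> polytime l -> polytime (fun a => take (n a) (l a)).
Proof.
move=> Hn Hl.
apply: (polytime_eq (f := fun a => rev (drop (size (l a) - n a) (rev (l a))))).
  move=> a; rewrite drop_rev revK; have [le_n|lt_n] := leqP (n a) (size (l a)).
    by rewrite subKn.
  by rewrite (eqnP (ltnW lt_n)) subn0 take_size take_oversize // ltnW.
apply/polytime_rev/polytime_drop; last exact: polytime_rev.
by apply: polytime_subn => //; apply: polytime_size.
Qed.

Lemma esize_nat (n : nat) : esize n = (n + n).+1.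
Proof.
elim: n => // n IH; change (esize n.+1) with (1 + esize n).+1; rewrite IH; lia.
Qed.

Lemma polytime_find A B {EA : Enc A} {EB : Enc B} (h : B -> A -> bool) (l : A -> seq B) :
  polytime l -> polytime (fun q => h q.1 q.2) ->
  polytime (fun a => find (fun x => h x a) (l a)).
Proof.
move=> Hl Hh; have [cl [kl Hcl]] := polytime_size_bound Hl.
apply: (polytime_eq (f := fun a => foldr (fun x r => if h x a then 0 else r.+1) 0 (l a))).
  by move=> a; elim: (l a) => //= x s ->.
apply: (polytime_foldr (h := fun x r a => if h x a then 0 else r.+1)
  (b := fun s => cl * s ^ kl + cl * s ^ kl)) => //; first by polyb.
- move=> a s1 s2 def_l; apply: (@leq_trans (esize s2 + esize s2)).
    have -> : foldr (fun x r => if h x a then 0 else r.+1) 0 s2 = find (fun x => h x a) s2.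
      by elim: (s2) => //= x s ->.
    rewrite esize_nat; have := find_size (fun x => h x a) s2; pose proof (size_esize s2); lia.
  have : esize s2 <= cl * esize a ^ kl.
    by apply: leq_trans (Hcl a); rewrite def_l esize_suffix.
  lia.
- by repeat pt_base.
- apply: polytime_if; last by repeat pt_base.
    by apply: (polytime_comp (g := fun q => h q.1 q.2) (f := fun q => (q.1.1, q.2))) => //;
      repeat pt_base.
  by repeat pt_base.
Qed.

(** * The algorithm *)

Definition matrix := seq (seq bool).

Section Algorithm.

Implicit Types (M : matrix) (bv : seq bool) (s c C P S U W Z A tl : seq nat).

Definition edge M i j := nth false (nth [::] M i) j.

Definition vertices M := iota 0 (size M).

Definition simple_in M s := uniq s && all (fun x => x < size M) s.

(* Each entry c of a table is a path from its head, a vertex of U reached so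
   far, to its last vertex, a source. *)
Definition grow M U (tb : seq (seq nat)) :=
  take 1 [seq c <- [seq u :: p | u <- U, p <- tb]
    | [&& simple_in M c, edge M (head 0 c) (head 0 (behead c))
        & head 0 c \notin [seq head 0 p | p <- tb]]] ++ tb.

Definition search M S U := iter (size U) (grow M U) [seq [:: w] | w <- S].

(* The result is a cycle through the last vertex of the path W, or empty if
   that vertex has no neighbour on W. *)
Definition close_cycle M W := drop (find (edge M (last 0 W)) W) W.

(* A path if P is one and its vertex number j is adjacent to its head. *)
Definition rotation P j := rev (take j P) ++ drop j P.

(** An index into [P]: the first neighbour of the head met on the reversed path, translated back. *)
Definition last_nbr M P := (size P - find (edge M (head 0 P)) (rev P)).-1.

(* A lollipop is a pair (Z, tl) of sequences such that Z ++ tl is a path and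
   the ends of Z are adjacent: Z is the cycle, last 0 Z the vertex where the
   tail tl is attached. *)
Definition initial_lollipop M P : seq nat * seq nat :=
  (rotation (take (last_nbr M P).+1 P) (last_nbr M P), drop (last_nbr M P).+1 P).

(* An ear is listed from its end on the tail to its end on the cycle or in A. *)
Definition lollipop_ears M A Z tl :=
  [seq c <- [seq z :: p | z <- tl,
       p <- search M (A ++ take (size Z).-1 Z)
              [seq u <- vertices M | u \notin A ++ Z ++ tl]]
    | edge M (head 0 c) (head 0 (behead c))].

Definition skip_to_nbr M v s := drop (find (edge M v) s) s.

(* The part of Z that leads from a, away from v, to the last vertex of Z. *)
Definition anchor_arm Z v a :=
  if index a Z < index v Z then rcons (rev (take (index a Z) Z)) (last 0 Z)
  else drop (index a Z).+1 Z.

(* With A = take a P and a = last_nbr M P, the new cycle runs from the vertex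
   before the end of the ear c on the tail, through the core formed by the
   head of P and its neighbours, to that end.  If c starts in A, the core is
   rebuilt from P; otherwise c starts before or after the core in Z. *)
Definition add_ear M P A Z tl c : seq nat :=
  (if last 0 c \in A then
    rev (skip_to_nbr M (head 0 P) (drop (index (last 0 c) P).+1 (take (size A).+1 P))
         ++ anchor_arm Z (head 0 P) (nth 0 P (size A))
         ++ take (index (head 0 c) tl) tl)
      ++ take (index (last 0 c) P).+1 P
  else if index (last 0 c) Z < index (head 0 P) Z then
    rev (drop (index (last 0 c) Z) Z ++ take (index (head 0 c) tl) tl)
  else rev (take (index (head 0 c) tl) tl)
      ++ last 0 Z :: take (index (last 0 c) Z).+1 Z) ++ behead (rev c).

(* The guard never fails on a 2-connected graph; it bounds the size of the
   states when M and P are arbitrary. *)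
Definition guard_lollipop M (st st' : seq nat * seq nat) :=
  if simple_in M (st'.1 ++ st'.2) then st' else st.

Definition lollipop_along M P A (st : seq nat * seq nat) c :=
  if nilp c then st else
  guard_lollipop M st
    (add_ear M P A st.1 st.2 c, drop (index (head 0 c) st.2).+1 st.2).

Definition lollipop_step M P (st : seq nat * seq nat) :=
  lollipop_along M P (take (last_nbr M P) P) st
    (head [::] (lollipop_ears M (take (last_nbr M P) P) st.1 st.2)).

Definition lollipop M P k :=
  iter k (lollipop_step M P) (initial_lollipop M P).

Definition is_cycle_of M C :=
  [&& simple_in M C, sorted (edge M) (rcons C (head 0 C)) & 2 < size C].

Definition cycles_of_path M P :=
  [seq C <- [seq close_cycle M (rotation P j) | j <- vertices M]
         ++ [seq close_cycle M ((lollipop M P k).1 ++ (lollipop M P k).2)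
               | k <- vertices M]
     | is_cycle_of M C].

Definition trim bv s :=
  rev (drop (find (fun x => ~~ nth false bv x) (rev s)) (rev s)).

(** The path [p] leads to a vertex of [C]; from there the result makes one full turn around [C]. *)
Definition unroll C p := p ++ behead (rot (index (last 0 p) C) C).

Definition paths_into_cycle M bv C :=
  [seq trim bv (unroll C p) | p <- search M C [seq u <- vertices M | u \notin C]].

Definition candidate_paths M bv P :=
  [seq u :: P | u <- vertices M] ++ [seq u :: rev P | u <- vertices M]
  ++ flatten [seq paths_into_cycle M bv C | C <- cycles_of_path M P].

Definition is_path_of M bv P :=
  [&& simple_in M P, sorted (edge M) P, ~~ nth false bv (head 0 P)
    & ~~ nth false bv (last 0 P)].

Definition weight bv s := size [seq x <- s | ~~ nth false bv x].

Definition better_paths M bv P :=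
  [seq Q <- candidate_paths M bv P | is_path_of M bv Q && (weight bv P < weight bv Q)].

Definition improve M bv P :=
  if nilp (better_paths M bv P) then P else head [::] (better_paths M bv P).

Definition initial_path M bv :=
  take 1 [seq x <- vertices M | ~~ nth false bv x].

Definition optimal_path M bv := iter (size M) (improve M bv) (initial_path M bv).

Definition longest (cs : seq (seq nat)) : seq nat :=
  foldr (fun c r => if size r < size c then c else r) [::] cs.

(* The second run, for an empty set B, provides a cycle even if the first one
   fails because G - B has minimum degree at most 1. *)
Definition long_cycle M bv :=
  longest (cycles_of_path M (optimal_path M bv)
             ++ cycles_of_path M (optimal_path M [::])).

Lemma simple_in_size (M : matrix) s : simple_in M s -> size s <= size M.
Proof.
move=> /andP[us /allP lts]; rewrite -(size_iota 0 (size M)).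
by apply: uniq_leq_size => // x /lts; rewrite mem_iota.
Qed.

Lemma improve_cases M bv P :
  better_paths M bv P = [::] /\ improve M bv P = P \/
  [/\ improve M bv P \in candidate_paths M bv P, is_path_of M bv (improve M bv P)
    & weight bv P < weight bv (improve M bv P)].
Proof.
rewrite /improve; case def_l: (better_paths M bv P) => [|Q l] /=; first by left.
right; have: Q \in better_paths M bv P by rewrite def_l mem_head.
by rewrite mem_filter => /andP[/andP[]].
Qed.

End Algorithm.

(** * The algorithm runs in polynomial time *)

(** Closure lemmas let every argument depend on an ambient value, which is the form that [pt] can
    apply to subterms. This lemma and the next two derive that form from the uncurried function. *)
Lemma polytime_open2 A B C D {EA : Enc A} {EB : Enc B} {EC : Enc C} {ED : Enc D}
    (f : A -> B -> C) (g : D -> A) (h : D -> B) :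
  polytime (fun q => f q.1 q.2) -> polytime g -> polytime h ->
  polytime (fun d => f (g d) (h d)).
Proof.
move=> Hf Hg Hh.
apply: (polytime_comp (g := fun q => f q.1 q.2) (f := fun d => (g d, h d))) => //.
exact: polytime_pair.
Qed.

Lemma polytime_open3 A B C D E {EA : Enc A} {EB : Enc B} {EC : Enc C} {ED : Enc D}
    {EE : Enc E} (f : A -> B -> C -> E) (g : D -> A) (h : D -> B) (k : D -> C) :
  polytime (fun q => f q.1.1 q.1.2 q.2) -> polytime g -> polytime h -> polytime k ->
  polytime (fun d => f (g d) (h d) (k d)).
Proof.
move=> Hf Hg Hh Hk.
apply: (polytime_open2 (f := fun q => f q.1 q.2) (g := fun d => (g d, h d))) => //.
exact: polytime_pair.
Qed.

Lemma polytime_open4 A B C D E F {EA : Enc A} {EB : Enc B} {EC : Enc C} {ED : Enc D}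
    {EE : Enc E} {EF : Enc F} (f : A -> B -> C -> E -> F)
    (g : D -> A) (h : D -> B) (k : D -> C) (l : D -> E) :
  polytime (fun q => f q.1.1.1 q.1.1.2 q.1.2 q.2) ->
  polytime g -> polytime h -> polytime k -> polytime l ->
  polytime (fun d => f (g d) (h d) (k d) (l d)).
Proof.
move=> Hf Hg Hh Hk Hl.
apply: (polytime_open3 (f := fun q => f q.1 q.2) (g := fun d => (g d, h d))) => //.
exact: polytime_pair.
Qed.

(** Extension point of [pt], redefined as more functions of the algorithm are known to be
    polynomial. *)
Ltac pt_hook := fail.
Ltac pt_step := cbv beta; first
  [ pt_base
  | pt_hook
  | simple eapply polytime_cat | simple eapply polytime_rcons
  | simple eapply polytime_rev | simple eapply polytime_map
  | simple eapply polytime_filter | simple eapply polytime_has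
  | simple eapply polytime_all | simple eapply polytime_flatten
  | simple eapply polytime_size | simple eapply polytime_drop
  | simple eapply polytime_take
  | (simple eapply polytime_nth; [reflexivity | | ])
  | (simple eapply polytime_head; [reflexivity | ])
  | (simple eapply polytime_last; [reflexivity | ])
  | simple eapply polytime_subn | simple eapply polytime_leq
  | simple eapply polytime_eqn
  | simple eapply polytime_find ].
Ltac pt := repeat pt_step.

Lemma polytime_mem A {EA : Enc A} (x : A -> nat) (s : A -> seq nat) :
  polytime x -> polytime s -> polytime (fun a => x a \in s a).
Proof.
move=> Hx Hs; apply: (polytime_eq (f := fun a => has (fun y => y == x a) (s a))).
  by move=> a; rewrite has_pred1.
apply: (polytime_has (h := fun y a => y == x a)) => //.
by apply: polytime_eqn; [pt | apply: polytime_comp Hx _; pt].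
Qed.

Lemma polytime_index A {EA : Enc A} (x : A -> nat) (s : A -> seq nat) :
  polytime x -> polytime s -> polytime (fun a => index (x a) (s a)).
Proof.
move=> Hx Hs; apply: (polytime_find (h := fun y a => y == x a)) => //.
by apply: polytime_eqn; [pt | apply: polytime_comp Hx _; pt].
Qed.

Lemma polytime_uniq A {EA : Enc A} (s : A -> seq nat) :
  polytime s -> polytime (fun a => uniq (s a)).
Proof.
move=> Hs.
apply: (polytime_eq
  (f := fun a => all (fun x => size [seq y <- s a | y == x] <= 1) (s a))) => [a|].
  apply/allP/idP => [H|Hu x _]; last by rewrite size_filter count_uniq_mem //; case: (_ \in _).
  apply: count_mem_uniq => x; have [xs|/count_memPn ->//] := boolP (x \in s a).
  by apply/eqP; rewrite eqn_leq -size_filter H //= size_filter -has_count has_pred1.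
apply: (polytime_all (h := fun x a => size [seq y <- s a | y == x] <= 1)) => //.
apply: polytime_leq; last by pt.
apply: polytime_size; apply: (polytime_filter (h := fun y q => y == q.1)); last by pt.
by apply: polytime_comp Hs _; pt.
Qed.

Lemma esize_below n (s : seq nat) :
  all (fun x => x < n) s -> esize s <= size s * (n + n + 2) + 1.
Proof.
elim: s => // x s IH /= /andP[lt_x /IH le_s]; rewrite esize_cons esize_nat; lia.
Qed.

Lemma polytime_iota A {EA : Enc A} (n : A -> nat) :
  polytime n -> polytime (fun a => iota 0 (n a)).
Proof.
move=> Hn; have [c [k Hc]] := polytime_size_bound Hn.
have iotaE m : foldr (fun _ r => rcons r (size r)) [::] (nseq m tt) = iota 0 m.
  elim: m => // m IH; rewrite -[m.+1 in RHS]addn1 iotaD /= add0n cats1.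
  by rewrite IH size_iota.
apply: (polytime_eq (fun a => iotaE (n a))).
apply: (polytime_foldr (h := fun _ r _ => rcons r (size r))
  (b := fun s => c * s ^ k * (c * s ^ k + c * s ^ k + 2) + 1)) => //; first by polyb.
- move=> a s1 s2 def_n.
  have s2E : s2 = nseq (size s2) tt by elim: (s2) => //= -[] s <-.
  rewrite s2E iotaE.
  have le_s : size s2 <= c * esize a ^ k.
    apply: leq_trans (Hc a); rewrite esize_nat.
    by rewrite -{1}(size_nseq (n a) tt) def_n size_cat; lia.
  apply: (@leq_trans (size s2 * (size s2 + size s2 + 2) + 1)).
    rewrite -{2}(size_iota 0 (size s2)); apply: esize_below.
    by apply/allP => x; rewrite mem_iota.
  by rewrite leq_add2r leq_mul // leq_add2r leq_add.
- by apply: polytime_nseq_unit.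
- by pt.
- by pt.
Qed.

Lemma simple_in_esize (M : matrix) s : simple_in M s ->
  esize s <= esize M * (esize M + esize M + 2) + 1.
Proof.
move=> okM; have := simple_in_size okM; case/andP: okM => _ lts le_s.
have lt_M := ltnW (size_esize M).
apply: leq_trans (esize_below lts) _.
by rewrite leq_add2r leq_mul ?leq_add // (leq_trans le_s).
Qed.

Ltac pt_hook ::= first
  [ simple eapply polytime_mem | simple eapply polytime_index
  | simple eapply polytime_uniq ].

Ltac pt_hook ::= first
  [ simple eapply polytime_mem | simple eapply polytime_index
  | simple eapply polytime_uniq | simple eapply polytime_iota ].

Lemma polytime_edge A {EA : Enc A} (M : A -> matrix) (i j : A -> nat) :
  polytime M -> polytime i -> polytime j -> polytime (fun a => edge (M a) (i a) (j a)).
Proof. by apply: polytime_open3; rewrite /edge; pt. Qed.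

Lemma polytime_vertices A {EA : Enc A} (M : A -> matrix) :
  polytime M -> polytime (fun a => vertices (M a)).
Proof. by move=> HM; rewrite /vertices; pt. Qed.

Lemma polytime_simple_in A {EA : Enc A} (M : A -> matrix) (s : A -> seq nat) :
  polytime M -> polytime s -> polytime (fun a => simple_in (M a) (s a)).
Proof. by apply: polytime_open2; rewrite /simple_in; pt. Qed.

Ltac pt_graph := first
  [ simple eapply polytime_mem | simple eapply polytime_index
  | simple eapply polytime_uniq | simple eapply polytime_iota
  | simple eapply polytime_edge | simple eapply polytime_vertices
  | simple eapply polytime_simple_in ].
Ltac pt_hook ::= pt_graph.

Lemma polytime_grow A {EA : Enc A} (M : A -> matrix) (U : A -> seq nat)
    (tb : A -> seq (seq nat)) :
  polytime M -> polytime U -> polytime tb ->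
  polytime (fun a => grow (M a) (U a) (tb a)).
Proof. by apply: polytime_open3; rewrite /grow; pt. Qed.

(** Bounds the code of a list of at most [n] numbers below [n]: each number takes at most 2 n + 1,
    its cons node one more, and the end of the list one. *)
Definition path_size_bound n := n * (n + n + 2) + 1.

Lemma esize_grow (M : matrix) U tb :
  esize (grow M U tb) <= esize tb + path_size_bound (esize M) + 1.
Proof.
rewrite /grow; set l := [seq _ <- _ | _].
have : all (simple_in M) l.
  by apply/allP => c; rewrite mem_filter => /andP[/and3P[]].
case: l => [_|c l /= /andP[/simple_in_esize le_c _]]; rewrite /=; first lia.
rewrite take0 cat0s esize_cons /path_size_bound; lia.
Qed.

Lemma polytime_search A {EA : Enc A} (M : A -> matrix) (S U : A -> seq nat) :
  polytime M -> polytime S -> polytime U ->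
  polytime (fun a => search (M a) (S a) (U a)).
Proof.
apply: polytime_open3; rewrite /search.
have Hz : polytime (fun q : matrix * seq nat * seq nat => [seq [:: w] | w <- q.1.2]) by pt.
have [c [k Hc]] := polytime_size_bound Hz.
apply: (polytime_iter (h := fun r q => grow q.1.1 q.2 r)
  (b := fun s => c * s ^ k + s * (path_size_bound s + 1))) => //.
- by rewrite /path_size_bound; polyb.
- case=> [[M' S'] U'] m /= le_m; set z := [seq _ | _ <- _].
  set s := esize (M', S', U').
  have le_s : size U' <= s /\ esize M' <= s.
    rewrite /s !esize_pair; pose proof (size_esize U'); lia.
  (* A round adds at most one simple path, so the table grows only additively. *)
  apply: (@leq_trans (esize z + m * (path_size_bound s + 1))).
    elim: m {le_m} => [|m IH]; first by rewrite mul0n addn0.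
    rewrite iterS; apply: leq_trans (esize_grow _ _ _) _.
    have : path_size_bound (esize M') <= path_size_bound s.
      by rewrite /path_size_bound leq_add2r leq_mul ?leq_add //; lia.
    rewrite mulSn; move: IH; set e := esize (iter _ _ _); lia.
  apply: leq_add; first exact: (Hc (M', S', U')).
  by rewrite leq_mul2r; apply/orP; right; lia.
- by pt.
- by apply: polytime_grow; pt.
Qed.

Lemma polytime_skip_to_nbr A {EA : Enc A} (M : A -> matrix) (v : A -> nat)
    (s : A -> seq nat) :
  polytime M -> polytime v -> polytime s ->
  polytime (fun a => skip_to_nbr (M a) (v a) (s a)).
Proof. by apply: polytime_open3; rewrite /skip_to_nbr; pt. Qed.

Lemma polytime_close_cycle A {EA : Enc A} (M : A -> matrix) (W : A -> seq nat) :
  polytime M -> polytime W -> polytime (fun a => close_cycle (M a) (W a)).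
Proof. by apply: polytime_open2; rewrite /close_cycle; pt. Qed.

Lemma polytime_rotation A {EA : Enc A} (P : A -> seq nat) (j : A -> nat) :
  polytime P -> polytime j -> polytime (fun a => rotation (P a) (j a)).
Proof. by apply: polytime_open2; rewrite /rotation; pt. Qed.

Lemma polytime_last_nbr A {EA : Enc A} (M : A -> matrix) (P : A -> seq nat) :
  polytime M -> polytime P -> polytime (fun a => last_nbr (M a) (P a)).
Proof. by apply: polytime_open2; rewrite /last_nbr; pt. Qed.

Ltac pt_hook ::= first
  [ pt_graph | simple eapply polytime_search | simple eapply polytime_skip_to_nbr
  | simple eapply polytime_close_cycle | simple eapply polytime_rotation
  | simple eapply polytime_last_nbr ].

Lemma polytime_initial_lollipop A {EA : Enc A} (M : A -> matrix) (P : A -> seq nat) :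
  polytime M -> polytime P -> polytime (fun a => initial_lollipop (M a) (P a)).
Proof. by apply: polytime_open2; rewrite /initial_lollipop; pt. Qed.

Lemma polytime_lollipop_ears A {EA : Enc A} (M : A -> matrix) (S Z tl : A -> seq nat) :
  polytime M -> polytime S -> polytime Z -> polytime tl ->
  polytime (fun a => lollipop_ears (M a) (S a) (Z a) (tl a)).
Proof. by apply: polytime_open4; rewrite /lollipop_ears; pt. Qed.

Lemma polytime_add_ear A {EA : Enc A} (M : A -> matrix) (P S Z tl c : A -> seq nat) :
  polytime M -> polytime P -> polytime S -> polytime Z -> polytime tl -> polytime c ->
  polytime (fun a => add_ear (M a) (P a) (S a) (Z a) (tl a) (c a)).
Proof.
move=> HM HP HS HZ Htl Hc.
apply: (polytime_open4
  (f := fun q Z tl c => add_ear q.1.1 q.1.2 q.2 Z tl c)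
  (g := fun a => (M a, P a, S a))) => //; last by pt.
by rewrite /add_ear /anchor_arm; pt.
Qed.

Lemma polytime_lollipop_along A {EA : Enc A} (M : A -> matrix) (P S : A -> seq nat)
    (st : A -> seq nat * seq nat) (c : A -> seq nat) :
  polytime M -> polytime P -> polytime S -> polytime st -> polytime c ->
  polytime (fun a => lollipop_along (M a) (P a) (S a) (st a) (c a)).
Proof.
move=> HM HP HS Hst Hc.
apply: (polytime_open3 (f := fun q st c => lollipop_along q.1.1 q.1.2 q.2 st c)
  (g := fun a => (M a, P a, S a))) => //; last by pt.
rewrite /lollipop_along; apply: polytime_if; try by pt.
apply: (polytime_open3 (f := guard_lollipop)); try by pt.
  by rewrite /guard_lollipop; pt.
by apply: polytime_pair; [apply: polytime_add_ear; pt | pt].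
Qed.

Lemma polytime_lollipop_step A {EA : Enc A} (M : A -> matrix) (P : A -> seq nat)
    (st : A -> seq nat * seq nat) :
  polytime M -> polytime P -> polytime st ->
  polytime (fun a => lollipop_step (M a) (P a) (st a)).
Proof.
apply: polytime_open3; rewrite /lollipop_step.
apply: polytime_lollipop_along; pt.
by apply: polytime_lollipop_ears; pt.
Qed.

(** By the guard, a step either keeps the state or yields one made of distinct vertices of [M], so
    sizes do not compound over the iterations. *)
Lemma lollipop_bounded (M : matrix) (P : seq nat) k :
  esize (lollipop M P k) <=
    esize (initial_lollipop M P) + path_size_bound (esize M) + 2.
Proof.
have okP (st : seq nat * seq nat) : simple_in M (st.1 ++ st.2) ->
    esize st <= path_size_bound (esize M) + 2.
  case: st => Z tl /simple_in_esize; rewrite esize_pair /path_size_bound /=.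
  pose proof (esize_cat Z tl); lia.
elim: k => [|k IH]; first by rewrite /lollipop /=; lia.
rewrite /lollipop iterS -/(lollipop M P k) /lollipop_step /lollipop_along.
case: ifP => // _; rewrite /guard_lollipop; case: ifP => // /okP; lia.
Qed.

Lemma polytime_lollipop A {EA : Enc A} (M : A -> matrix) (P : A -> seq nat)
    (k : A -> nat) :
  polytime M -> polytime P -> polytime k ->
  polytime (fun a => lollipop (M a) (P a) (k a)).
Proof.
apply: polytime_open3; rewrite /lollipop.
have Hz : polytime (fun q : matrix * seq nat * nat => initial_lollipop q.1.1 q.1.2).
  by apply: polytime_initial_lollipop; pt.
have [c [d Hc]] := polytime_size_bound Hz.
apply: (polytime_iter (h := fun r q => lollipop_step q.1.1 q.1.2 r)
  (b := fun s => c * s ^ d + path_size_bound s + 2)) => //.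
- by rewrite /path_size_bound; polyb.
- case=> [[M' P'] k'] m _ /=; apply: leq_trans (lollipop_bounded M' P' m) _.
  rewrite leq_add2r; apply: leq_add; first exact: (Hc (M', P', k')).
  rewrite /path_size_bound leq_add2r.
  have le_M : esize M' <= esize (M', P', k') by rewrite !esize_pair; lia.
  by rewrite leq_mul ?leq_add.
- by pt.
- by apply: polytime_lollipop_step; pt.
Qed.

Lemma polytime_sorted_edge A {EA : Enc A} (M : A -> matrix) (s : A -> seq nat) :
  polytime M -> polytime s -> polytime (fun a => sorted (edge (M a)) (s a)).
Proof.
apply: (polytime_open2 (f := fun M s => sorted (edge M) s)).
apply: (polytime_eq (f := fun q => all (fun i =>
  edge q.1 (nth 0 q.2 i) (nth 0 q.2 i.+1)) (iota 0 (size q.2).-1))); last by pt.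
move=> [M' s'] /=; apply/allP/(sortedP 0) => H i Hi; apply: H.
  by rewrite mem_iota /= add0n; case: s' Hi.
by move: Hi; rewrite mem_iota /= add0n; case: s'.
Qed.

Ltac pt_hook ::= first
  [ pt_graph | simple eapply polytime_search | simple eapply polytime_skip_to_nbr
  | simple eapply polytime_close_cycle | simple eapply polytime_rotation
  | simple eapply polytime_lollipop | simple eapply polytime_sorted_edge ].

Lemma polytime_is_cycle_of A {EA : Enc A} (M : A -> matrix) (C : A -> seq nat) :
  polytime M -> polytime C -> polytime (fun a => is_cycle_of (M a) (C a)).
Proof. by apply: polytime_open2; rewrite /is_cycle_of; pt. Qed.

Lemma polytime_cycles_of_path A {EA : Enc A} (M : A -> matrix) (P : A -> seq nat) :
  polytime M -> polytime P -> polytime (fun a => cycles_of_path (M a) (P a)).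
Proof.
apply: polytime_open2; rewrite /cycles_of_path; pt.
by apply: polytime_is_cycle_of; pt.
Qed.

Lemma polytime_trim A {EA : Enc A} (bv : A -> seq bool) (s : A -> seq nat) :
  polytime bv -> polytime s -> polytime (fun a => trim (bv a) (s a)).
Proof. by apply: polytime_open2; rewrite /trim; pt. Qed.

Lemma polytime_unroll A {EA : Enc A} (C p : A -> seq nat) :
  polytime C -> polytime p -> polytime (fun a => unroll (C a) (p a)).
Proof. by apply: polytime_open2; rewrite /unroll /rot; pt. Qed.

Lemma polytime_is_path_of A {EA : Enc A} (M : A -> matrix) (bv : A -> seq bool)
    (P : A -> seq nat) :
  polytime M -> polytime bv -> polytime P ->
  polytime (fun a => is_path_of (M a) (bv a) (P a)).
Proof. by apply: polytime_open3; rewrite /is_path_of; pt. Qed.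

Ltac pt_hook ::= first
  [ pt_graph | simple eapply polytime_search
  | simple eapply polytime_cycles_of_path | simple eapply polytime_trim
  | simple eapply polytime_unroll | simple eapply polytime_is_path_of ].

Lemma polytime_candidate_paths A {EA : Enc A} (M : A -> matrix) (bv : A -> seq bool)
    (P : A -> seq nat) :
  polytime M -> polytime bv -> polytime P ->
  polytime (fun a => candidate_paths (M a) (bv a) (P a)).
Proof.
by apply: polytime_open3; rewrite /candidate_paths /paths_into_cycle; pt.
Qed.

Lemma polytime_better_paths A {EA : Enc A} (M : A -> matrix) (bv : A -> seq bool)
    (P : A -> seq nat) :
  polytime M -> polytime bv -> polytime P ->
  polytime (fun a => better_paths (M a) (bv a) (P a)).
Proof.
apply: polytime_open3; rewrite /better_paths /weight; pt.
by apply: polytime_candidate_paths; pt.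
Qed.

Lemma polytime_improve A {EA : Enc A} (M : A -> matrix) (bv : A -> seq bool)
    (P : A -> seq nat) :
  polytime M -> polytime bv -> polytime P ->
  polytime (fun a => improve (M a) (bv a) (P a)).
Proof.
by apply: polytime_open3; rewrite /improve; pt; apply: polytime_better_paths; pt.
Qed.

Lemma polytime_optimal_path A {EA : Enc A} (M : A -> matrix) (bv : A -> seq bool) :
  polytime M -> polytime bv -> polytime (fun a => optimal_path (M a) (bv a)).
Proof.
apply: polytime_open2; rewrite /optimal_path.
have Hz : polytime (fun q : matrix * seq bool => initial_path q.1 q.2).
  by rewrite /initial_path; pt.
have [c [d Hc]] := polytime_size_bound Hz.
apply: (polytime_iter (h := fun r q => improve q.1 q.2 r)
  (b := fun s => c * s ^ d + path_size_bound s)) => //.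
- by rewrite /path_size_bound; polyb.
- case=> [M' bv'] m _; rewrite [fst _]/= [snd _]/=.
  have le_M : esize M' <= esize (M', bv') by rewrite esize_pair; lia.
  elim: m => [|m IH]; first by apply: leq_trans (leq_addr _ _); exact: (Hc (M', bv')).
  (* An accepted candidate is a simple path, so its size is bounded independently of the path that
     it replaces. *)
  rewrite iterS; have [[_ ->]//|[_ /andP[/simple_in_esize le_p _] _]] :=
    improve_cases M' bv' (iter m (improve M' bv') (initial_path M' bv')).
  apply: leq_trans le_p _; apply: leq_trans (leq_addl _ _).
  by rewrite /path_size_bound leq_add2r leq_mul ?leq_add.
- by pt.
- by apply: polytime_improve; pt.
Qed.

Lemma polytime_longest A {EA : Enc A} (cs : A -> seq (seq nat)) :
  polytime cs -> polytime (fun a => longest (cs a)).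
Proof.
move=> Hcs; have [c [d Hc]] := polytime_size_bound Hcs.
apply: (polytime_foldr (h := fun c r _ => if size r < size c then c else r)
  (b := fun s => c * s ^ d)) => //; first by polyb.
- move=> a s1 s2 def_cs; apply: leq_trans (Hc a); rewrite def_cs.
  apply: leq_trans (esize_suffix s1 s2).
  elim: (s2) => //= x s IH; rewrite esize_cons; case: ifP => _; lia.
- by pt.
- by pt.
Qed.

Lemma polytime_long_cycle :
  polytime (fun q : matrix * seq bool => long_cycle q.1 q.2).
Proof.
rewrite /long_cycle; apply: polytime_longest; pt; apply: polytime_optimal_path; pt.
Qed.

(** * Correctness on adjacency matrices *)

Lemma head_rev (s : seq nat) : head 0 (rev s) = last 0 s.
Proof. by case/lastP: s => [|s x] //; rewrite rev_rcons last_rcons. Qed.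

Lemma last_rev (s : seq nat) : last 0 (rev s) = head 0 s.
Proof. by case: s => [|x s] //; rewrite rev_cons last_rcons. Qed.

Lemma sorted_cat (e : rel nat) s t : sorted e s -> sorted e t ->
  (s != [::] -> t != [::] -> e (last 0 s) (head 0 t)) -> sorted e (s ++ t).
Proof.
case: s => [|x s] //= Hs; case: t => [|y t] /= Ht H; first by rewrite cats0.
by rewrite cat_path Hs /= H.
Qed.

Lemma sorted_rev (e : rel nat) s : symmetric e -> sorted e s -> sorted e (rev s).
Proof.
by move=> e_sym; rewrite rev_sorted; apply: sub_sorted => x y; rewrite e_sym.
Qed.

(** The last clause states 2-connectivity by cuts: after deleting [v], some edge leaves every proper
    part [S]. If [v] is not below [size M], nothing is deleted and it expresses connectedness. *)
Definition two_connected (M : matrix) :=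
  [/\ symmetric (edge M), irreflexive (edge M),
      (forall i j, edge M i j -> i < size M) &
      forall v (S : pred nat),
        (exists2 x, x < size M & S x && (x != v)) ->
        (exists2 y, y < size M & ~~ S y && (y != v)) ->
        exists x y, [/\ S x, ~~ S y, x != v, y != v & edge M x y]].

(** * Paths to a set of sources found by search *)

Section TwoConnected.
Variable M : matrix.
Hypothesis M2 : two_connected M.
Local Notation e := (edge M).

Let e_sym : symmetric e. Proof. by case: M2. Qed.
Let e_irr : irreflexive e. Proof. by case: M2. Qed.
Let e_lt i j : e i j -> i < size M. Proof. by case: M2 => _ _ H _; apply: H. Qed.

Lemma mem_vertices x : (x \in vertices M) = (x < size M).
Proof. by rewrite mem_iota. Qed.

Section Search.
Variables S U : seq nat.
Hypothesis S_lt : all (fun x => x < size M) S.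
Hypothesis U_lt : all (fun x => x < size M) U.

Definition access_path (p : seq nat) :=
  exists q w, [/\ p = rcons q w, w \in S, all (mem U) q, simple_in M p & sorted e p].

(** By the third clause every vertex of a listed path is itself a head, so a vertex that is no head
    can be put before any listed path without repetition. The fourth clause counts the rounds: each
    one that changes the table makes a new vertex of [U] a head. *)
Definition access_table (tb : seq (seq nat)) :=
  [/\ forall p, p \in tb -> access_path p,
      forall w, w \in S -> [:: w] \in tb,
      forall p x, p \in tb -> x \in p -> x \in [seq head 0 p | p <- tb] &
      exists nw, [/\ tb = nw ++ [seq [:: w] | w <- S],
        uniq [seq head 0 p | p <- nw] & {subset [seq head 0 p | p <- nw] <= U}]].

Definition saturated (tb : seq (seq nat)) :=
  forall p u, p \in tb -> u \in U -> e u (head 0 p) -> u \in [seq head 0 p | p <- tb].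

Lemma grow_cases tb : access_table tb ->
  (grow M U tb = tb /\ saturated tb) \/
  [/\ access_table (grow M U tb), size (grow M U tb) = (size tb).+1 & ~ saturated tb].
Proof.
move=> [Tp TS Th [nw [def_tb u_nw nwU]]]; rewrite /grow.
set l := [seq c <- _ | _]; case def_l: l => [|c l'] /=.
  left; split=> // p u p_tb uU euh; apply/negPn/negP => u_hd.
  have [q [w [def_p wS qU /andP[up ltp] sp]]] := Tp p p_tb.
  suff: u :: p \in l by rewrite def_l.
  rewrite mem_filter allpairs_f // andbT /= u_hd euh /simple_in /= up ltp (allP U_lt) //=.
  by rewrite !andbT; apply: contra u_hd => /(Th p u p_tb).
right; have: c \in l by rewrite def_l mem_head.
rewrite take0 /= mem_filter => /andP[/and3P[sc eh c_hd]] /allpairsP[[u p] /=].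
move=> [uU p_tb def_c]; subst c; rewrite /= in eh c_hd.
have [q [w [def_p wS qU _ sp]]] := Tp p p_tb.
split=> //; last first.
  by move=> /(_ p u p_tb uU eh); rewrite (negPf c_hd).
split.
- move=> p'; rewrite inE => /predU1P[->|/Tp//]; exists (u :: q), w.
  split=> //; [by rewrite def_p | by rewrite /= uU |].
  by move: sp eh; rewrite /=; case: (p) => //= z r -> ->.
- by move=> w' /TS; rewrite inE => ->; rewrite orbT.
- move=> p' x; rewrite inE => /predU1P[->|p'_tb].
    rewrite inE /= => /predU1P[->|x_p]; first by rewrite mem_head.
    by rewrite inE (Th p x) ?orbT.
  by move=> x_p'; rewrite /= inE (Th p' x) ?orbT.
- exists ((u :: p) :: nw); rewrite def_tb; split=> //=.
    rewrite u_nw andbT; apply: contra c_hd => u_in.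
    by rewrite def_tb map_cat mem_cat u_in.
  by move=> x; rewrite inE => /predU1P[->|/nwU].
Qed.

(** If [size U] rounds all enlarge the table, they add [size U] distinct heads from [U]; then all of
    [U] are heads and the table is saturated anyway. *)
Lemma searchP :
  access_table (search M S U) /\ saturated (search M S U).
Proof.
have T0 : access_table [seq [:: w] | w <- S].
  split.
  - move=> p /mapP[w wS ->]; exists [::], w; split=> //.
    by rewrite /simple_in /= (allP S_lt).
  - by move=> w wS; apply: map_f.
  - move=> p x /mapP[w wS ->]; rewrite inE => /eqP->.
    by apply/mapP; exists [:: w] => //; apply: map_f.
  - by exists [::].
pose T k := iter k (grow M U) [seq [:: w] | w <- S].
have Tk k : access_table (T k) /\ (saturated (T k) \/ size (T k) = size S + k).
  elim: k => [|k [Tk Hk]]; first by split=> //; right; rewrite size_map addn0.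
  rewrite /T iterS -/(T k); have [[-> sat]|[Tk' sz nsat]] := grow_cases Tk.
    by split=> //; left.
  by split=> //; have [//|Hs] := Hk; right; rewrite sz Hs addnS.
have [TU [//|szU]] := Tk (size U); split=> // p u _ uU _.
have [_ _ _ [nw [def_T u_nw nwU]]] := TU.
rewrite /search -/(T _) def_T map_cat mem_cat; apply/orP; left.
have le_sz : size U <= size [seq head 0 p | p <- nw].
  by move: szU; rewrite def_T size_cat !size_map; lia.
by have [_ ->] := uniq_min_size u_nw nwU le_sz.
Qed.

End Search.
End TwoConnected.

Lemma trimP bv s : has (fun x => ~~ nth false bv x) s ->
  exists t, [/\ s = trim bv s ++ t, all (nth false bv) t, trim bv s != [::]
    & ~~ nth false bv (last 0 (trim bv s))].
Proof.
rewrite /trim -has_rev => Hs; set r := rev s; set k := find _ r.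
exists (rev (take k r)); split.
- by rewrite -rev_cat cat_take_drop revK.
- rewrite all_rev; apply/allP => x /(nthP 0)[i].
  rewrite size_take_min => lt_i <-; rewrite nth_take; last by lia.
  have lt_k : i < find (fun x => ~~ nth false bv x) r by rewrite -/k; lia.
  by have := before_find 0 lt_k => /negbFE.
- by rewrite -size_eq0 size_rev size_drop subn_eq0 -ltnNge -has_find.
- rewrite last_rev -nth0 nth_drop addn0; exact: (nth_find 0 Hs).
Qed.

(** * Moves through cycles and local optimality *)

Section TwoConnected.
Variable M : matrix.
Hypothesis M2 : two_connected M.
Local Notation e := (edge M).

Let e_sym : symmetric e. Proof. by case: M2. Qed.
Let e_irr : irreflexive e. Proof. by case: M2. Qed.
Let e_lt i j : e i j -> i < size M. Proof. by case: M2 => _ _ H _; apply: H. Qed.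

Lemma weight_cat bv s t : weight bv (s ++ t) = weight bv s + weight bv t.
Proof. by rewrite /weight filter_cat size_cat. Qed.

Lemma simple_in_catl s t : simple_in M (s ++ t) -> simple_in M s.
Proof. by rewrite /simple_in cat_uniq all_cat => /andP[/and3P[-> _ _] /andP[->]]. Qed.

Lemma simple_in_catr s t : simple_in M (s ++ t) -> simple_in M t.
Proof. by rewrite /simple_in cat_uniq all_cat => /andP[/and3P[_ _ ->] /andP[_ ->]]. Qed.

Lemma simple_in_perm s t : perm_eq s t -> simple_in M s = simple_in M t.
Proof. by move=> st; rewrite /simple_in (perm_uniq st) (perm_all _ st). Qed.

(** The search from [C] reaches [v]. Following the path found from [v] into [C] and then turning
    once around collects [v] and all of [C]; trimming loses only vertices of B. *)
Lemma path_into_cycle bv C v : is_cycle_of M C -> v < size M -> v \notin C ->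
  ~~ nth false bv v ->
  exists2 Q, Q \in paths_into_cycle M bv C
    & is_path_of M bv Q /\ weight bv C < weight bv Q.
Proof.
move=> /and3P[sC cC szC] lt_v vC vB.
set U := [seq u <- vertices M | u \notin C].
have U_lt : all (fun x => x < size M) U.
  by apply/allP => x; rewrite mem_filter mem_vertices => /andP[].
have C_lt : all (fun x => x < size M) C by case/andP: sC.
have [[Tp TS Th _] sat] := searchP C_lt U_lt.
set tb := search M C U in Tp TS Th sat *.
have hd_c w : w \in C -> w \in [seq head 0 p | p <- tb].
  by move=> /TS wT; apply/mapP; exists [:: w].
have v_hd : v \in [seq head 0 p | p <- tb].
  (* As [size M] is not a vertex, this is plain connectedness: an edge would leave the set of heads,
     against saturation. *)
  apply/negPn/negP => v_nhd; case: M2 => _ _ _ /(_ (size M) (mem [seq head 0 p | p <- tb])) [].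
  - have C0 : head 0 C \in C by case: (C) szC => // x C' _; rewrite mem_head.
    exists (head 0 C); first exact: (allP C_lt).
    by rewrite /= hd_c // neq_ltn (allP C_lt).
  - by exists v => //=; rewrite v_nhd neq_ltn lt_v.
  move=> x [y [/mapP[p p_tb ->] /negP y_hd _ _ epy]]; apply: y_hd.
  have [yC|yC] := boolP (y \in C); first exact: hd_c.
  apply: (sat p) => //; last by rewrite e_sym.
  by rewrite mem_filter yC mem_vertices (e_lt (j := head 0 p)) // e_sym.
have /mapP[p p_tb def_v] := v_hd.
have [q [w [def_p wC qU sp lp]]] := Tp p p_tb.
exists (trim bv (unroll C p)); first exact: map_f.
set i := index w C.
have def_Q : unroll C p = q ++ rot i C.
  rewrite /unroll def_p last_rcons -cats1 -catA; congr (_ ++ _).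
  by rewrite -/i /rot (drop_nth w) ?index_mem //= nth_index.
have qC x : x \in q -> x \notin C.
  by move=> xq; have: x \in U by [exact: (allP qU)]; rewrite mem_filter => /andP[].
have [z [q' def_q]] : exists z q', q = z :: q'.
  case: (q) def_p => [def_p|z q' _]; last by exists z, q'.
  by move: vC; rewrite def_v def_p wC.
have qv : head 0 q = v by rewrite def_v def_p def_q.
have sQ : simple_in M (unroll C p).
  rewrite def_Q /simple_in cat_uniq all_cat rot_uniq.
  have /andP[uC ->] : simple_in M (rot i C).
    by rewrite (simple_in_perm (_ : perm_eq _ C)) // perm_rot.
  move: sp; rewrite def_p -cats1 => /simple_in_catl/andP[-> ->].
  rewrite /= -[uniq C](rot_uniq i) uC !andbT.
  by apply/hasPn => x; rewrite mem_rot; apply: contraL => /qC.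
have rC : sorted e (rot i C).
  have : cycle e (rot i C).
    rewrite rot_cycle; case: (C) szC cC => //= x s _; by [].
  by case: (rot i C) => //= x s; rewrite rcons_path => /andP[].
have lQ : sorted e (unroll C p).
  rewrite def_Q; apply: sorted_cat => //.
    by move: lp; rewrite def_p -cats1 def_q /= cat_path => /andP[].
  move=> _ _; move: lp; rewrite def_p -cats1 def_q /= cat_path => /andP[_ /=].
  rewrite andbT /rot (drop_nth w) ?index_mem //= nth_index //.
have [t [def_t tB tr0 trl]] : exists t, [/\ unroll C p = trim bv (unroll C p) ++ t,
    all (nth false bv) t, trim bv (unroll C p) != [::]
    & ~~ nth false bv (last 0 (trim bv (unroll C p)))].
  apply: trimP; apply/hasP; exists v => //.
  by rewrite def_Q mem_cat -qv def_q mem_head.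
have wE : weight bv (unroll C p) = weight bv (trim bv (unroll C p)).
  rewrite {1}def_t weight_cat {2}/weight (_ : [seq _ <- t | _] = [::]) ?addn0 //.
  by apply/eqP; rewrite -(negbK (_ == _)) -has_filter -all_predC; apply/allP => x /(allP tB) /= ->.
split.
  rewrite def_t in sQ lQ; rewrite /is_path_of (simple_in_catl sQ) trl andbT /=.
  move: lQ tr0 def_t; rewrite def_Q def_q; case: (trim _ _) => //= x s.
  rewrite cat_path => /andP[-> _] _ [<- _]; by move: vB; rewrite -qv def_q.
rewrite -wE def_Q weight_cat /weight.
have -> : size [seq x <- rot i C | ~~ nth false bv x] = size [seq x <- C | ~~ nth false bv x].
  by rewrite !size_filter; apply/permP; rewrite perm_rot.
by move: vB; rewrite -qv def_q /= => -> /=; rewrite addSn ltnS leq_addl.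
Qed.

Definition locally_optimal bv P :=
  is_path_of M bv P /\
  forall Q, Q \in candidate_paths M bv P -> is_path_of M bv Q -> weight bv Q <= weight bv P.

Lemma initial_path_ok bv v : v < size M -> ~~ nth false bv v ->
  is_path_of M bv (initial_path M bv).
Proof.
move=> lt_v vB; rewrite /initial_path; set l := filter _ _.
have: v \in l by rewrite mem_filter vB mem_vertices.
case def_l: l => [//|x l'] _ /=; rewrite take0.
have: x \in l by rewrite def_l mem_head.
rewrite mem_filter mem_vertices => /andP[xB lt_x].
by rewrite /is_path_of /simple_in /= lt_x xB.
Qed.

(** Each improvement raises the weight, which never exceeds [size M]. So after [size M] rounds the
    iteration is stuck or has reached the greatest possible weight. *)
Lemma optimal_path_ok bv v : v < size M -> ~~ nth false bv v ->
  locally_optimal bv (optimal_path M bv).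
Proof.
move=> lt_v vB; pose T k := iter k (improve M bv) (initial_path M bv).
have le_n Q : is_path_of M bv Q -> weight bv Q <= size M.
  move=> /andP[/simple_in_size le_Q _]; apply: leq_trans le_Q.
  by rewrite /weight size_filter count_size.
have Tk k : is_path_of M bv (T k) /\ (locally_optimal bv (T k) \/ k <= weight bv (T k)).
  elim: k => [|k [Tk Hk]]; first by split; [exact: initial_path_ok lt_v vB | right].
  rewrite /T iterS -/(T k).
  have [[better0 ->]|[T'T T'ok lt_T]] := improve_cases M bv (T k).
    split=> //; left; split=> // Q QT Qok; rewrite leqNgt; apply/negP => lt_Q.
    suff: Q \in better_paths M bv (T k) by rewrite better0.
    by rewrite mem_filter Qok lt_Q.
  split=> //; right; have [[_ opt]|le_k] := Hk; last exact: leq_ltn_trans lt_T.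
  by have := opt _ T'T T'ok; rewrite leqNgt lt_T.
have [Tn [//|le_T]] := Tk (size M); split=> // Q _ /le_n le_Q.
exact: leq_trans le_T.
Qed.

End TwoConnected.

Lemma last_drop k (s : seq nat) : k < size s -> last 0 (drop k s) = last 0 s.
Proof. move=> lt_k; rewrite -!nth_last nth_drop size_drop; congr nth; lia. Qed.

(** * Neighbours of the ends of an optimal path and crossing pairs *)

Section Optimal.
Variable M : matrix.
Hypothesis M2 : two_connected M.
Local Notation e := (edge M).

Let e_sym : symmetric e. Proof. by case: M2. Qed.
Let e_irr : irreflexive e. Proof. by case: M2. Qed.
Let e_lt i j : e i j -> i < size M. Proof. by case: M2 => _ _ H _; apply: H. Qed.

Lemma close_cycle_is_cycle W : simple_in M W -> sorted e W ->
  has (e (last 0 W)) W -> 2 < size (close_cycle M W) ->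
  is_cycle_of M (close_cycle M W).
Proof.
move=> sW lW hW sz; rewrite /is_cycle_of sz andbT; apply/andP; split.
  by rewrite /close_cycle; move: sW; rewrite -{1}(cat_take_drop (find (e (last 0 W)) W) W) => /simple_in_catr.
rewrite -cats1; apply: sorted_cat => //; first exact: drop_sorted.
move=> _ _ /=; rewrite /close_cycle -nth0 nth_drop addn0.
set k := find _ _; have lt_k : k < size W by rewrite -has_find.
by rewrite last_drop //; exact: nth_find.
Qed.

Variables (bv : seq bool) (P : seq nat) (d : nat).
Hypothesis optP : locally_optimal M bv P.
Hypothesis ex_v : exists2 v, v < size M & ~~ nth false bv v.
Hypothesis deg_d : forall v, v < size M -> ~~ nth false bv v ->
  d <= count (fun u => e v u && ~~ nth false bv u) (vertices M).
Hypothesis d_gt1 : 1 < d.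

Local Notation B := (nth false bv).
Local Notation v0 := (head 0 P).
Local Notation vm := (last 0 P).
Local Notation p := (nth 0 P).

Lemma optimal_path_neq0 : P != [::].
Proof.
have [v lt_v vB] := ex_v; apply/negP => /eqP P0; case: optP => _.
rewrite P0 => /(_ [:: v]); rewrite /weight /= vB => H.
suff: 0 < 0 by []; apply: H; last by rewrite /is_path_of /simple_in /= lt_v vB.
by rewrite mem_cat; apply/orP; left; apply: map_f; rewrite mem_vertices.
Qed.

Lemma optimal_path_simple : simple_in M P.
Proof. by case: optP => /and4P[]. Qed.

Lemma optimal_path_sorted : sorted e P.
Proof. by case: optP => /and4P[]. Qed.

Lemma head_nbr u : e v0 u -> ~~ B u -> u \in P.
Proof.
move=> e0 uB; apply/negPn/negP => uP.
have lt_u : u < size M by rewrite (@e_lt _ v0) // e_sym.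
have [/and4P[sP lP hP tP] /(_ (u :: P))] := optP.
rewrite /weight /= uB ltnn => H; suff: false by []; apply: H.
  by rewrite mem_cat; apply/orP; left; apply: map_f; rewrite mem_vertices.
move: sP lP hP tP e0 uP; rewrite /is_path_of /simple_in.
case: (P) optimal_path_neq0 => //= x s _ /andP[us lts] ps xB tB e0 us'.
by rewrite us' us lt_u lts uB tB e_sym e0 ps.
Qed.

Lemma last_nbr_mem u : e vm u -> ~~ B u -> u \in P.
Proof.
move=> e0 uB; apply/negPn/negP => uP.
have lt_u : u < size M by rewrite (@e_lt _ vm) // e_sym.
have [/and4P[sP lP hP tP] /(_ (u :: rev P))] := optP.
rewrite /weight /= uB filter_rev /= size_rev ltnn => H; suff: false by []; apply: H.
  rewrite !mem_cat; apply/orP; right; apply/orP; left.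
  by apply: map_f; rewrite mem_vertices.
have lr := sorted_rev e_sym lP.
move: sP lr; rewrite /is_path_of /simple_in -rev_uniq -all_rev /= mem_rev uP uB lt_u.
move=> /andP[-> ->] lr /=; rewrite -head_rev in e0.
case def_r: (rev P) lr e0 => [|x s] /=.
  by move/(congr1 rev): def_r optimal_path_neq0; rewrite revK => ->.
move=> -> e0; rewrite e_sym e0 /=.
by move: hP; rewrite -last_rev def_r.
Qed.

Lemma degree_in_path v : v < size M -> ~~ B v ->
  (forall u, e v u -> ~~ B u -> u \in P) -> d <= count (e v) P.
Proof.
move=> lt_v vB H; apply: leq_trans (deg_d lt_v vB) _; rewrite -!size_filter.
apply: uniq_leq_size; first by rewrite filter_uniq // iota_uniq.
move=> u; rewrite !mem_filter => /andP[/andP[eu uB] _].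
by rewrite eu H.
Qed.

Definition nbr_indices v := [seq j <- iota 0 (size P) | e v (p j)].

Lemma mem_nbr_indices v j : (j \in nbr_indices v) = (j < size P) && e v (p j).
Proof. by rewrite mem_filter mem_iota add0n andbC. Qed.

Lemma size_nbr_indices v : size (nbr_indices v) = count (e v) P.
Proof. by rewrite -[P in RHS](mkseq_nth 0) count_map size_filter. Qed.

Lemma head_index : v0 = p 0. Proof. by rewrite nth0. Qed.
Lemma last_index : vm = p (size P).-1. Proof. by rewrite nth_last. Qed.

Lemma path_gt0 : 0 < size P.
Proof. by rewrite lt0n size_eq0 optimal_path_neq0. Qed.

Lemma path_lt i : i < size P -> p i < size M.
Proof. by move=> lt_i; case/andP: optimal_path_simple => _ /allP; apply; exact: mem_nth. Qed.

Lemma path_le : size P <= size M.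
Proof. exact: simple_in_size optimal_path_simple. Qed.

Lemma d_le_head : d <= size (nbr_indices v0).
Proof.
have [/and4P[_ _ hB _] _] := optP.
rewrite size_nbr_indices degree_in_path //; last exact: head_nbr.
by rewrite head_index path_lt // path_gt0.
Qed.

Lemma d_le_last : d <= size (nbr_indices vm).
Proof.
have [/and4P[_ _ _ tB] _] := optP.
rewrite size_nbr_indices degree_in_path //; last exact: last_nbr_mem.
by rewrite last_index path_lt // ltn_predL path_gt0.
Qed.

Local Notation goal_size := (minn (count (fun v => ~~ B v) (vertices M)) (d + d)).

(** A vertex outside B that is missing from [C] would give, by [path_into_cycle], a candidate
    heavier than [C] and hence heavier than [P]. So [C] contains all vertices outside B. *)
Lemma covering_cycle C : C \in cycles_of_path M P -> weight bv P <= weight bv C ->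
  goal_size <= size C.
Proof.
move=> CP le_w; rewrite geq_min; apply/orP; left; rewrite -size_filter.
apply: uniq_leq_size => [|v]; first by rewrite filter_uniq // iota_uniq.
rewrite mem_filter mem_vertices => /andP[vB lt_v]; apply/negPn/negP => vC.
have okC : is_cycle_of M C by move: CP; rewrite mem_filter => /andP[].
have [Q QC [Qok lt_Q]] := path_into_cycle M2 okC lt_v vC vB.
have [_ /(_ Q)] := optP; rewrite leqNgt (leq_ltn_trans le_w) // => H.
suff: false by []; apply: H => //; rewrite !mem_cat; apply/orP; right.
by apply/orP; right; apply/flattenP; exists (paths_into_cycle M bv C) => //; exact: map_f.
Qed.

(** The rotation reads p (j - 1), ..., p 0, p j, ..., vm. As vm has no neighbour strictly between,
    the first one met is p i, at position [j - i.+1]; the cycle misses exactly the vertices strictly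
    between p i and p j. *)
Lemma rotation_cycle i j : i < j < size P -> e v0 (p j) -> e vm (p i) ->
  (forall k, i < k < j -> ~~ e vm (p k)) ->
  [/\ close_cycle M (rotation P j) = rev (take i.+1 P) ++ drop j P,
      simple_in M (rotation P j), sorted e (rotation P j) &
      has (e (last 0 (rotation P j))) (rotation P j)].
Proof.
move=> /andP[lt_ij lt_j] e0 em nadj; set W := rotation P j.
have lastW : last 0 W = vm.
  by rewrite /W /rotation last_cat -(last_drop lt_j); case: (drop j P) (size_drop j P) => //=; lia.
have nthW t : t < j -> nth 0 W t = p (j - t.+1).
  move=> lt_t; rewrite /W /rotation nth_cat size_rev size_take lt_j lt_t.
  by rewrite nth_rev ?size_take lt_j // nth_take //; lia.
have szW : size W = size P by rewrite size_cat size_rev size_take size_drop lt_j; lia.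
have hasW : has (e vm) W.
  apply/(has_nthP 0); exists (j - i.+1); first by lia.
  by rewrite nthW; [rewrite (_ : j - _ = i) //; lia | lia].
have findW : find (e vm) W = j - i.+1.
  have lt_f : find (e vm) W < size W by rewrite -has_find.
  have := nth_find 0 hasW; set k := find _ _ in lt_f *.
  have le_k : k <= j - i.+1.
    rewrite leqNgt; apply/negP => lt_k; have := before_find 0 lt_k.
    by rewrite nthW; [rewrite (_ : j - _ = i) ?em //; lia | lia].
  rewrite nthW; last by lia.
  move=> ek; apply/eqP; rewrite eqn_leq le_k /= leqNgt; apply/negP => lt_k.
  have lt_jk : i < j - k.+1 < j by lia.
  by have := nadj _ lt_jk; rewrite ek.
split; last by rewrite lastW.
- rewrite /close_cycle lastW findW /W /rotation drop_cat size_rev size_take lt_j.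
  rewrite ifT; last by lia.
  congr (_ ++ _); rewrite drop_rev size_take lt_j; congr rev.
  by rewrite take_takel ?leq_subr //; congr take; lia.
- rewrite (@simple_in_perm M _ P) ?optimal_path_simple //.
  by rewrite -[P in perm_eq _ P](cat_take_drop j P) perm_cat2r perm_rev.
- apply: sorted_cat; first exact/(sorted_rev e_sym)/take_sorted/optimal_path_sorted.
    exact/drop_sorted/optimal_path_sorted.
  move=> _ _; rewrite last_rev -!nth0 nth_drop addn0 nth_take ?nth0 //; lia.
Qed.

Lemma crossing_cycle i0 j0 : i0 < j0 < size P -> e v0 (p j0) -> e vm (p i0) ->
  exists2 C, C \in cycles_of_path M P & goal_size <= size C.
Proof.
move=> lt0 e00 em0.
pose cr i j := [&& i < j, j < size P, e v0 (p j) & e vm (p i)].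
pose gap g := has (fun i => cr i (i + g)) (iota 0 (size P)).
have gapP i j : cr i j -> gap (j - i).
  move=> cr_ij; have /and4P[lt_ij lt_j _ _] := cr_ij.
  apply/hasP; exists i; first by rewrite mem_iota; lia.
  by rewrite subnKC // ltnW.
have ex_gap : exists g, gap g.
  by exists (j0 - i0); apply: gapP; case/andP: lt0 => h1 h2; rewrite /cr h1 h2 e00.
(* Minimality of the gap excludes neighbours of either end strictly between i and j. *)
case: (ex_minnP ex_gap) => g /hasP[i _ cr_ij] min_g.
have {gapP} min_cr i' j' : cr i' j' -> g <= j' - i' by move=> /gapP/min_g.
set j := i + g in cr_ij; have /and4P[lt_ij lt_j e0 em] := cr_ij.
have nadj k : i < k < j -> ~~ e vm (p k).
  move=> /andP[lt_ik lt_kj]; apply/negP => ek.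
  by have := min_cr k j; rewrite /cr lt_kj lt_j e0 ek => /(_ isT); lia.
have nadj0 k : i < k < j -> ~~ e v0 (p k).
  move=> /andP[lt_ik lt_kj]; apply/negP => ek.
  by have := min_cr i k; rewrite /cr lt_ik (ltn_trans lt_kj) // ek em => /(_ isT); lia.
have [|CE sW lW hW] := rotation_cycle _ e0 em nadj; first by rewrite lt_ij.
set C := close_cycle M _ in CE.
have szC : size C = i.+1 + (size P - j).
  by rewrite CE size_cat size_rev size_drop size_takel // (leq_trans lt_ij (ltnW lt_j)).
have CP : 2 < size C -> C \in cycles_of_path M P.
  move=> sz; rewrite mem_filter close_cycle_is_cycle //= mem_cat.
  apply/orP; left; apply/mapP; exists j => //.
  by rewrite mem_vertices (leq_trans lt_j) // path_le.
(* With gap 1 nothing is skipped and [C] is a permutation of [P]; it has more than two vertices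
   because the d > 1 neighbours of [v0] have positions other than 0. *)
have [g1|g1] := eqVneq g 1.
  have wE : perm_eq C P.
    rewrite CE -[P in perm_eq _ P](cat_take_drop j P) /j g1 addn1.
    by rewrite perm_cat2r perm_rev.
  have gt2 : 2 < size C.
    rewrite (perm_size wE); have := d_le_head.
    have : size (nbr_indices v0) <= size (iota 1 (size P).-1).
      apply: uniq_leq_size => [|k]; first by rewrite filter_uniq // iota_uniq.
      rewrite mem_nbr_indices mem_iota; case: k => [|k].
        by rewrite head_index e_irr andbF.
      by move=> /andP[lt_k _]; move: lt_k; clear; case: (size P) => //=; lia.
    move=> le_s le_d; have := leq_trans d_gt1 (leq_trans le_d le_s).
    by rewrite size_iota; case: (size P) => [|[|[|k]]].
  exists C; first exact: CP.
  apply: covering_cycle; first exact: CP.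
  by rewrite /weight !size_filter (permP wE).
(* A neighbour of vm directly before a neighbour of [v0] would be a crossing of gap 1, so the two
   lists of positions are disjoint. Both lie in 0, ..., i and j - 1, ..., m - 1, where m is the last
   index: as many positions as [C] has vertices. *)
have le_dd : d + d <= size C.
  apply: (@leq_trans (size (map predn (nbr_indices v0) ++ nbr_indices vm))).
    by rewrite size_cat size_map leq_add // ?d_le_head ?d_le_last.
  have -> : size C = size (iota 0 i.+1 ++ iota j.-1 (size P - j)).
    by rewrite size_cat !size_iota.
  have pos k : k \in nbr_indices v0 -> 0 < k.
    by case: k => //; rewrite mem_nbr_indices head_index e_irr andbF.
  apply: uniq_leq_size.
    rewrite cat_uniq !filter_uniq ?iota_uniq // andbT.
    rewrite map_inj_in_uniq ?filter_uniq ?iota_uniq //; last first.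
      by move=> k l /pos k0 /pos l0; move: k0 l0; clear; lia.
    apply/hasPn => k; rewrite mem_nbr_indices => /andP[lt_k ek].
    apply/mapP => -[l l0 def_k]; have := pos _ l0; move: l0.
    rewrite mem_nbr_indices => /andP[lt_l el] l_gt0.
    have lt_kl : k < l by rewrite def_k prednK.
    have := min_cr k l; rewrite /cr lt_kl lt_l el ek => /(_ isT).
    by move: lt_ij g1 lt_kl; rewrite def_k /j; clear; lia.
  move=> k; rewrite !mem_cat !mem_iota => /orP[/mapP[l l0 ->]|].
    have := pos _ l0; move: l0; rewrite mem_nbr_indices => /andP[lt_l el].
    have := nadj0 l; rewrite el /=.
    by move: lt_ij lt_j lt_l; clear; lia.
  rewrite mem_nbr_indices => /andP[lt_k ek].
  have k_neq : k <> (size P).-1 by move=> def_k; move: ek; rewrite last_index def_k e_irr.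
  have := nadj k; rewrite ek /=.
  by move: lt_ij lt_j lt_k k_neq; clear; lia.
have gt2 : 2 < size C by move: d_gt1 le_dd; clear; lia.
by exists C; [exact: CP | rewrite geq_min le_dd orbT].
Qed.

End Optimal.

Ltac alia := repeat match goal with
  | H : ?T |- _ => lazymatch T with
    | is_true (leq _ _) => fail
    | is_true (leq _ _ && leq _ _) => fail
    | @eq nat _ _ => fail
    | nat => fail
    | _ => clear H
    end
  end;
  (* Unifies the occurrences of [size] at [nat] and at its [eqType] carrier. *)
  repeat match goal with
  | |- context [@size ?T ?s] =>
      lazymatch T with nat => fail | _ => change (@size T s) with (@size nat s) end
  | H : context [@size ?T ?s] |- _ =>
      lazymatch T with nat => fail | _ => change (@size T s) with (@size nat s) in H end
  end; lia.

Lemma index_split (s1 s2 : seq nat) x :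
  x \notin s1 -> index x (s1 ++ x :: s2) = size s1.
Proof. by move=> /negPf x1; rewrite index_cat x1 /= eqxx addn0. Qed.

Lemma sorted_overlap (e : rel nat) s x t :
  sorted e (rcons s x) -> sorted e (x :: t) -> sorted e (rcons s x ++ t).
Proof.
move=> ss st; apply: sorted_cat => //; first exact: path_sorted st.
by move=> _; rewrite last_rcons; case: t st => //= y t /andP[].
Qed.

(** * Shortening the tail of a lollipop *)

Section Lollipop.
Variable M : matrix.
Hypothesis M2 : two_connected M.
Local Notation e := (edge M).

Let e_sym : symmetric e. Proof. by case: M2. Qed.
Let e_irr : irreflexive e. Proof. by case: M2. Qed.
Let e_lt i j : e i j -> i < size M. Proof. by case: M2 => _ _ H _; apply: H. Qed.

Variables (P : seq nat) (a : nat).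
Local Notation v0 := (head 0 P).
Local Notation p := (nth 0 P).
Hypothesis P_simple : simple_in M P.
Hypothesis P_sorted : sorted e P.
Hypothesis aE : a = last_nbr M P.
Hypothesis v0_nbr : has (e v0) P.

Let P_uniq : uniq P. Proof. by case/andP: P_simple. Qed.

Lemma mem_take_path i k : i < size P -> (p i \in take k P) = (i < k).
Proof. by move=> lt_i; rewrite in_take ?mem_nth // index_uniq. Qed.

Lemma mem_drop_path i k : i < size P -> (p i \in drop k P) = (k <= i).
Proof.
move=> lt_i; have := mem_nth 0 lt_i; rewrite -[X in _ \in X](cat_take_drop k P) mem_cat.
have := P_uniq; rewrite -{1}(cat_take_drop k P) cat_uniq => /and3P[_ /hasPn H _].
rewrite mem_take_path // (leqNgt k i); case: ltnP => //= lt_k _.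
by apply/negbTE/negP => /H; rewrite /= mem_take_path // lt_k.
Qed.

Lemma mem_segment x k t : x \in take t (drop k P) ->
  exists2 i, k <= i < k + t & i < size P /\ x = p i.
Proof.
move=> /(nthP 0)[i]; rewrite size_take_min size_drop leq_min => /andP[lt_t lt_i] <-.
exists (k + i); first by rewrite leq_addr ltn_add2l.
by split; [rewrite -ltn_subRL | rewrite nth_take ?nth_drop].
Qed.

Lemma path_edge i : i.+1 < size P -> e (p i) (p i.+1).
Proof. by move=> lt_i; move/(sortedP 0): P_sorted; apply. Qed.

Lemma last_nbr_facts :
  [/\ 0 < a < size P, e v0 (p a) & forall j, a < j < size P -> ~~ e v0 (p j)].
Proof.
have hr : has (e v0) (rev P) by rewrite has_rev.
have lt_f : find (e v0) (rev P) < size P by rewrite -(size_rev P) -has_find.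
have := nth_find 0 hr; have bf := before_find 0 (a := e v0) (s := rev P).
rewrite aE /last_nbr; set f := find _ _ in lt_f bf *.
rewrite nth_rev // => ef; set k := (size P - f).-1.
have kE : k = size P - f.+1 by rewrite /k subnS.
rewrite kE; split=> //.
- apply/andP; split; last by alia.
  by rewrite lt0n; apply/eqP => k0; move: ef; rewrite k0 nth0 e_irr.
- move=> j /andP[lt_j lt_jP]; apply/negP => ej.
  have lt_jf : size P - j.+1 < f by alia.
  have := bf _ lt_jf; rewrite nth_rev; last by alia.
  by rewrite (_ : size P - _ = j) ?ej //; alia.
Qed.

Let a_gt0 : 0 < a. Proof. by have [/andP[]] := last_nbr_facts. Qed.
Let a_lt : a < size P. Proof. by have [/andP[]] := last_nbr_facts. Qed.
Let e_a : e v0 (p a). Proof. by have [] := last_nbr_facts. Qed.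
Let v0E : v0 = p 0. Proof. by rewrite nth0. Qed.
Let v0_neq_a : v0 != p a. Proof. by apply: contraTneq e_a => <-; rewrite e_irr. Qed.

Local Notation A := (take a P).
Local Notation Aa := (take a.+1 P).

Lemma mem_Aa x : (x \in Aa) = (x \in A) || (x == p a).
Proof. by rewrite (take_nth 0) // mem_rcons inE orbC. Qed.

(* The core K1 ++ v0 :: K2 contains v0 and all its neighbours on P, and p a is
   one of its ends. *)
Definition core_of Z := exists Z1 K1 K2 Z3,
  [/\ Z = Z1 ++ K1 ++ v0 :: K2 ++ Z3,
      {subset K1 ++ K2 <= Aa},
      forall x, x \in P -> e v0 x -> x \in K1 ++ K2,
      forall x, x \in Z1 ++ Z3 -> x \notin Aa &
      (exists K', K1 = p a :: K') \/ (exists K', K2 = rcons K' (p a))].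

(** The cycle is listed from p (y - 1) to p y, where the tail [drop y.+1 P] is attached, so its
    closing edge is an edge of [P]. The clause for y = a covers the initial lollipop, the only one
    whose point of attachment lies in [Aa]. *)
Definition lollipop_inv Z y :=
  [/\ a <= y < size P, last 0 Z = p y /\ head 0 Z = p y.-1, sorted e Z,
      simple_in M (Z ++ drop y.+1 P) &
      (y = a -> {subset Z <= Aa}) /\ core_of Z].

Lemma segment_cons y t : y < size P ->
  p y :: take t (drop y.+1 P) = drop y (take (y + t.+1) P).
Proof. by move=> lt_y; rewrite addnC -take_drop (drop_nth 0 lt_y). Qed.

Lemma last_segment y t : y + t < size P ->
  last 0 (p y :: take t (drop y.+1 P)) = p (y + t).
Proof.
move=> lt_yt; rewrite segment_cons; last by alia.
rewrite -nth_last nth_drop size_drop size_take_min nth_take; last by alia.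
by congr nth; alia.
Qed.

Lemma sorted_segment y t : y < size P -> sorted e (p y :: take t (drop y.+1 P)).
Proof. by move=> lt_y; rewrite segment_cons //; apply/drop_sorted/take_sorted. Qed.

(** The common part of the three ways to use an ear: [E] is the ear without its end on the cycle or
    in [A], and [Y] is an arc that leads to this end from p (y + t), the vertex before the end of
    the ear on the tail. *)
Lemma lollipop_extend Z y t Y E :
  lollipop_inv Z y -> y + t.+1 < size P ->
  simple_in M E -> sorted e E -> E != [::] -> last 0 E = p (y + t.+1) ->
  (forall x, x \in E -> x \notin Aa ++ Z) ->
  (forall x, x \in E -> x \in drop y.+1 P -> x = p (y + t.+1)) ->
  uniq Y -> sorted e Y -> {subset Y <= Aa ++ Z ++ take t (drop y.+1 P)} ->
  e (last 0 Y) (head 0 E) -> core_of Y ->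
  (exists R, Y = rev (p y :: take t (drop y.+1 P)) ++ R) ->
  lollipop_inv (Y ++ E) (y + t.+1).
Proof.
move=> [/andP[le_y lt_y] [_ _] sZ simZ [_ _]] lt_yt simE sE E0 lE EA Etl uY sY YA eYE coreY.
move=> [R def_Y]; set tl := drop y.+1 P in simZ Etl YA def_Y.
have hY : head 0 Y = p (y + t).
  rewrite def_Y -last_segment; last by alia.
  rewrite -head_rev; case def_r: (rev _) => [|z r] //=.
  by move: (congr1 size def_r); rewrite size_rev.
have Y0 : Y != [::] by rewrite def_Y rev_cons -cats1; case: (rev _).
have Z_tl x : x \in Z -> x \notin tl.
  move=> xZ; apply/negP => xtl; case/andP: simZ; rewrite cat_uniq => /and3P[_ /hasPn/(_ x xtl)].
  by rewrite /= xZ.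
have Y_E x : x \in Y -> x \notin E.
  move=> xY; apply/negP => xE; have := EA x xE; rewrite mem_cat negb_or => /andP[xA xZ].
  have := YA x xY; rewrite !mem_cat (negPf xA) (negPf xZ) /= => xT.
  have [i /andP[ge_i lt_i] [lt_iP def_x]] := mem_segment xT.
  have /eqP := Etl x xE (mem_take xT); rewrite def_x nth_uniq // => /eqP; alia.
have D_sub x : x \in drop (y + t.+1).+1 P -> x \in tl.
  rewrite (_ : (y + t.+1).+1 = t.+1 + y.+1) -?drop_drop; first exact: mem_drop.
  alia.
have Y_D x : x \in drop (y + t.+1).+1 P -> x \notin Y.
  move=> xD; apply/negP => /YA; rewrite !mem_cat.
  have xtl := D_sub x xD.
  have /(nthP 0)[j lt_j def_x] : x \in P by apply: mem_drop xD.
  move: xD; rewrite -def_x mem_drop_path // => le_j.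
  rewrite def_x; case/or3P => [|/Z_tl|/mem_segment].
  - by rewrite -def_x mem_take_path //; alia.
  - by rewrite xtl.
  - case=> i /andP[ge_i lt_i] [lt_iP def_xi].
    by have /eqP := etrans def_x def_xi; rewrite nth_uniq // => /eqP; alia.
have E_D x : x \in drop (y + t.+1).+1 P -> x \notin E.
  move=> xD; apply/negP => xE; have def_x := Etl x xE (D_sub x xD).
  by move: xD; rewrite def_x mem_drop_path // ltnn.
have lt_all x : x \in Aa ++ Z ++ take t tl -> x < size M.
  rewrite !mem_cat; case/or3P => [/mem_take|xZ|/mem_take/mem_drop].
  - by case/andP: P_simple => _ /allP; apply.
  - by case/andP: simZ => _ /allP; apply; rewrite mem_cat xZ.
  - by case/andP: P_simple => _ /allP; apply.
split.
- alia.
- split; first by rewrite last_cat -lE; case: (E) E0.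
  rewrite (_ : (y + _).-1 = y + t); last by alia.
  by rewrite -hY; case: (Y) Y0.
- by apply: sorted_cat.
- rewrite /simple_in !cat_uniq !all_cat uY drop_uniq //=.
  case/andP: simE => -> ->; rewrite andbT.
  have -> : all (fun x => x < size M) Y by apply/allP => x /YA /lt_all.
  have -> : all (fun x => x < size M) (drop (y + t.+1).+1 P).
    by apply/allP => x /mem_drop; case/andP: P_simple => _ /allP; apply.
  rewrite !andbT; apply/andP; split.
    by apply/hasPn => x xE; apply: contraL xE => /Y_E.
  by apply/hasPn => x xD; rewrite /= mem_cat negb_or Y_D ?E_D.
- split; first by alia.
  have [Z1 [K1 [K2 [Z3 [def_Y' KA KN ZA Ka]]]]] := coreY.
  exists Z1, K1, K2, (Z3 ++ E); split=> //.
    by rewrite def_Y' -!catA /= -!catA.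
  move=> x; rewrite !mem_cat orbA => /orP[xZ|/EA].
    by apply: ZA; rewrite mem_cat.
  by rewrite mem_cat negb_or => /andP[].
Qed.

Lemma uniq_split (s1 s2 : seq nat) x : uniq (s1 ++ x :: s2) ->
  [/\ x \notin s1, x \notin s2 & forall z, z \in s1 -> z \notin s2].
Proof.
rewrite cat_uniq /= => /and4P[_ /norP[xs1 /hasPn H] xs2 _]; split=> // z zs1.
by apply: contraL zs1 => /H.
Qed.

(** Since p a is an end of the core, one of the two directions along the cycle leads from it to p y
    without meeting [v0], and there the cycle avoids [Aa]. *)
Lemma anchor_armP Z y : lollipop_inv Z y ->
  [/\ uniq (anchor_arm Z v0 (p a)), {subset anchor_arm Z v0 (p a) <= Z},
      forall x, x \in anchor_arm Z v0 (p a) -> x \notin Aa &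
      exists R, p a :: anchor_arm Z v0 (p a) = rcons R (p y) /\
                sorted e (rcons R (p y))].
Proof.
move=> [/andP[le_y lt_y] [lZ hZ] sZ simZ [_ [Z1 [K1 [K2 [Z3 [def_Z KA KN ZA Ka]]]]]]].
have uZ : uniq Z by case/andP: (simple_in_catl simZ).
have paA : p a \in Aa by rewrite mem_take_path.
have [v0L v0R LR] : [/\ v0 \notin Z1 ++ K1, v0 \notin K2 ++ Z3
    & forall z, z \in Z1 ++ K1 -> z \notin K2 ++ Z3].
  by apply: uniq_split; rewrite -catA -def_Z.
have iv0 : index v0 Z = size (Z1 ++ K1) by rewrite def_Z catA index_split.
(* If p a begins the core, the arm goes back through [Z1] to p (y - 1) and takes the closing edge to
   p y; if p a ends the core, the arm is [Z3], which is empty when y = a. *)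
rewrite /anchor_arm iv0; case: Ka => [[K' def_K]|[K' def_K]].
  have paZ1 : p a \notin Z1.
    by apply: contraL paA => paZ; apply: ZA; rewrite mem_cat paZ.
  have ipa : index (p a) Z = size Z1 by rewrite def_Z def_K index_split.
  rewrite ipa size_cat def_K /= -[X in X < _]addn0 ltn_add2l /= lZ.
  have -> : take (size Z1) Z = Z1 by rewrite def_Z take_size_cat.
  have py_in : p y \in v0 :: K2 ++ Z3.
    by rewrite -lZ def_Z catA last_cat /= mem_last.
  have pyL : p y \notin Z1 ++ K1.
    by move: py_in; rewrite inE => /predU1P[->//|]; apply: contraL => /LR.
  split.
  - rewrite rcons_uniq rev_uniq mem_rev.
    move: uZ; rewrite def_Z cat_uniq => /andP[-> _]; rewrite andbT.
    by apply: contra pyL; rewrite mem_cat => ->.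
  - move=> x; rewrite mem_rcons inE mem_rev => /predU1P[->|xZ1].
      by rewrite def_Z catA mem_cat py_in orbT.
    by rewrite def_Z mem_cat xZ1.
  - move=> x; rewrite mem_rcons inE mem_rev => /predU1P[->|xZ1]; last first.
      by apply: ZA; rewrite mem_cat xZ1.
    rewrite mem_take_path // -leqNgt ltn_neqAle le_y andbT.
    by apply: contraNneq pyL => <-; rewrite mem_cat def_K mem_head orbT.
  - exists (p a :: rev Z1); split=> //.
    rewrite -rev_rcons -cats1; apply: sorted_cat => //.
      apply: (sorted_rev e_sym); move: sZ.
      have -> : Z = rcons Z1 (p a) ++ (K' ++ v0 :: K2 ++ Z3).
        by rewrite cat_rcons def_Z def_K.
      by move=> /cat_sorted2[].
    move=> _ _ /=; rewrite last_rev.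
    have -> : head 0 (rcons Z1 (p a)) = p y.-1.
      by rewrite -hZ def_Z def_K; case: (Z1).
    have y_gt0 : 0 < y by exact: leq_trans le_y.
    by have := @path_edge y.-1; rewrite prednK // e_sym => ->.
have uZ' : uniq ((Z1 ++ K1 ++ v0 :: K') ++ p a :: Z3).
  by rewrite -!catA /= -(cat_rcons (p a)) -def_K -def_Z.
have def_Z' : Z = (Z1 ++ K1 ++ v0 :: K') ++ p a :: Z3.
  by rewrite def_Z def_K -!catA /= cat_rcons.
have [paL _ _] := uniq_split uZ'.
have ipa : index (p a) Z = size (Z1 ++ K1 ++ v0 :: K') by rewrite def_Z' index_split.
rewrite ipa ifF; last by rewrite catA !size_cat /=; apply/negbTE; rewrite -leqNgt leq_addr.
have -> : drop (size (Z1 ++ K1 ++ v0 :: K')).+1 Z = Z3.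
  by rewrite def_Z' -(size_rcons _ (p a)) -(cat_rcons (p a)) drop_size_cat.
split.
- by move: uZ'; rewrite cat_uniq => /and3P[_ _ /andP[]].
- by move=> x xZ3; rewrite def_Z' mem_cat inE xZ3 !orbT.
- by move=> x xZ3; apply: ZA; rewrite mem_cat xZ3 orbT.
- exists (belast (p a) Z3).
  have lZ3 : last (p a) Z3 = p y by rewrite -lZ def_Z' last_cat.
  rewrite -lZ3 -lastI; split=> //.
  by move: sZ; rewrite def_Z' => /cat_sorted2[].
Qed.

(** What [lollipop_extend] asks of an arc [Y] that ends at the end [w] of the ear. *)
Definition arc_ok Z y t w Y :=
  [/\ uniq Y, sorted e Y, {subset Y <= Aa ++ Z ++ take t (drop y.+1 P)},
      last 0 Y = w &
      core_of Y /\ exists R, Y = rev (p y :: take t (drop y.+1 P)) ++ R].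

Lemma segment_disjoint Z y t : lollipop_inv Z y ->
  [/\ uniq (p y :: take t (drop y.+1 P)),
      forall x, x \in take t (drop y.+1 P) -> x \notin Aa &
      forall x, x \in take t (drop y.+1 P) -> x \notin Z].
Proof.
move=> [/andP[le_y lt_y] _ _ simZ _]; split.
- by rewrite segment_cons // drop_uniq // take_uniq.
- move=> x /mem_segment[i /andP[lt_i _] [lt_iP ->]].
  by rewrite mem_take_path // -leqNgt; alia.
- move=> x /mem_take xtl; apply/negP => xZ.
  case/andP: simZ; rewrite cat_uniq => /and3P[_ /hasPn/(_ x xtl)].
  by rewrite /= xZ.
Qed.

Lemma skip_to_nbrP i : i < a -> exists2 r, i < r <= a &
  [/\ skip_to_nbr M v0 (drop i.+1 Aa) = drop r Aa, e v0 (p r) &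
      forall j, i < j < r -> ~~ e v0 (p j)].
Proof.
move=> lt_ia; rewrite /skip_to_nbr; set D := drop i.+1 Aa; set f := find _ D.
have szD : size D = a - i by rewrite size_drop size_takel // subSS.
have nthD j : j < a - i -> nth 0 D j = p (i.+1 + j).
  by move=> lt_j; rewrite nth_drop nth_take //; alia.
have hD : has (e v0) D.
  apply/(has_nthP 0); exists (a - i.+1); first by rewrite szD; alia.
  by rewrite nthD ?subnKC //; alia.
have lt_f : f < a - i by rewrite -szD -has_find.
exists (i.+1 + f); first by alia.
split; first by rewrite drop_drop addnC.
  by rewrite -nthD // nth_find.
move=> j /andP[lt_ij lt_j]; have lt_jf : j - i.+1 < f by alia.
have := before_find 0 lt_jf; rewrite nthD; last by alia.
by rewrite subnKC // => ->.
Qed.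

(** The arc goes back along the tail to p y, along the arm to p a, down [P] to p r, over to [v0] and
    up to p i. Of the old cycle it keeps only the arm, which avoids [Aa] and so cannot meet the new
    core. *)
Lemma arc_restart Z y t i : lollipop_inv Z y -> i < a ->
  arc_ok Z y t (p i)
    (rev (skip_to_nbr M v0 (drop i.+1 Aa) ++ anchor_arm Z v0 (p a)
          ++ take t (drop y.+1 P)) ++ take i.+1 P).
Proof.
move=> inv lt_ia; have [/andP[le_y lt_y] _ _ _ _] := inv.
have [u_arm armZ armA [R [def_R s_R]]] := anchor_armP inv.
have [u_T TA TZ] := segment_disjoint t inv.
have [r /andP[lt_ir le_ra] [-> er nr]] := skip_to_nbrP lt_ia.
set arm := anchor_arm _ _ _ in u_arm armZ armA def_R *.
set T := take t _ in u_T TA TZ *; set D := drop r Aa.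
have lt_iP : i < size P by alia.
have szD : size D = (a - r).+1 by rewrite size_drop size_takel // subSn.
have mem_D j : j < size P -> (p j \in D) = (r <= j <= a).
  move=> lt_j; rewrite /D -[Aa](cat_take_drop 0) take0 cat0s drop0.
  have -> : drop r Aa = take (a.+1 - r) (drop r P) by rewrite take_drop subnK // leqW.
  apply/idP/idP => [/mem_segment[k /andP[le_k lt_k] [lt_kP /eqP]]|/andP[le_r le_a]].
    by rewrite nth_uniq // => /eqP ->; alia.
  apply/(nthP 0); exists (j - r); first by rewrite size_take_min size_drop leq_min; alia.
  by rewrite nth_take ?nth_drop ?subnKC //; alia.
have DA x : x \in D -> x \in Aa by apply: mem_drop.
have last_D : last 0 D = p a.
  by rewrite last_drop ?size_takel // -nth_last size_takel // nth_take.
have head_D : head 0 D = p r by rewrite -nth0 nth_drop addn0 nth_take.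
have D0 : D != [::] by rewrite -size_eq0 szD.
have s_T : sorted e (p y :: T) by apply: sorted_segment.
have s_armT : sorted e (p a :: arm ++ T).
  by rewrite -cat_cons def_R; apply: sorted_overlap.
have u_armT : uniq (arm ++ T).
  have uT : uniq T by case/andP: u_T.
  rewrite cat_uniq u_arm uT andbT.
  by apply/hasPn => x xT; apply: contra (TZ x xT) => /armZ.
have armTA x : x \in arm ++ T -> x \notin Aa.
  by rewrite mem_cat => /orP[/armA|/TA].
have iA x : x \in take i.+1 P -> x \in Aa.
  have -> : take i.+1 P = take i.+1 Aa by rewrite take_takel //; alia.
  exact: mem_take.
have D_i x : x \in D -> x \notin take i.+1 P.
  move=> xD; have /(nthP 0)[j lt_j def_x] : x \in P by apply/mem_take/DA.
  move: xD; rewrite -def_x mem_D // mem_take_path // -leqNgt; alia.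
split.
- rewrite cat_uniq; apply/and3P; split; last exact: take_uniq.
    rewrite rev_uniq cat_uniq u_armT drop_uniq ?take_uniq // andbT.
    by apply/hasPn => x /armTA; apply: contra => /DA.
  apply/hasPn => x xi; rewrite /= mem_rev mem_cat negb_or.
  rewrite (contraL (@D_i x) xi) /=.
  by apply: contraL (iA x xi) => /armTA.
- apply: sorted_cat; last first.
  + move=> _ _; rewrite last_rev; have -> : head 0 (D ++ arm ++ T) = p r.
      by rewrite -head_D; case: (D) D0.
    by rewrite -nth0 nth_take // -v0E e_sym.
  + exact: take_sorted.
  apply: (sorted_rev e_sym); apply: sorted_cat; first exact/drop_sorted/take_sorted.
    exact: path_sorted s_armT.
  by move=> _; rewrite last_D; case: (arm ++ T) s_armT => //= x s /andP[].
- move=> x; rewrite !mem_cat mem_rev !mem_cat => /orP[/or3P[/DA ->//|/armZ ->|->]|/iA->] //;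
    by rewrite ?orbT.
- by rewrite last_cat -nth_last size_takel // nth_take //=; exact: set_nth_default.
split.
  exists (rev (arm ++ T)), (rev D), (behead (take i.+1 P)), [::].
  have def_i : take i.+1 P = v0 :: behead (take i.+1 P) by case: (P) a_lt.
  split.
  - by rewrite rev_cat -catA cats0 -def_i.
  - move=> x; rewrite mem_cat mem_rev => /orP[/DA//|xi].
    by apply: iA; rewrite def_i inE xi orbT.
  (* A neighbour of [v0] has index at most a, and by the choice of r either at least r or at most
     i. *)
  - move=> x /(nthP 0)[j lt_j <-] ej; rewrite mem_cat mem_rev mem_D //.
    have le_ja : j <= a.
      by rewrite leqNgt; apply/negP => lt_aj; have [_ _ /(_ j)] := last_nbr_facts; rewrite lt_aj lt_j ej => /(_ isT).
    have [le_rj|lt_jr] := leqP r j; first by rewrite le_ja.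
    have le_ji : j < i.+1.
      by rewrite ltnNge; apply/negP => lt_ij; have := nr j; rewrite lt_ij lt_jr ej => /(_ isT).
    have : p j \in take i.+1 P by rewrite mem_take_path.
    rewrite def_i inE => /predU1P[ej0|->]; last by rewrite orbT.
    by move: ej; rewrite ej0 e_irr.
  - by move=> x; rewrite cats0 mem_rev => /armTA.
  - left; exists (behead (rev D)).
    by rewrite -last_D -head_rev; case def_D: (rev D) => [|x s] //; move: (congr1 size def_D); rewrite size_rev szD.
have [D' def_D] : exists D', D = rcons D' (p a).
  by case/lastP: (D) D0 last_D => // D' x _; rewrite last_rcons => ->; exists D'.
exists (rev (D' ++ R) ++ take i.+1 P).
rewrite [RHS]catA -rev_cat; congr (rev _ ++ _).
by rewrite def_D cat_rcons -[p a :: _]cat_cons def_R cat_rcons catA.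
Qed.


Lemma rcons_last_lollipop Z y : lollipop_inv Z y ->
  exists Zb, Z = rcons Zb (p y) /\ p y \notin Zb.
Proof.
move=> [_ [lZ _] _ simZ [_ [Z1 [K1 [K2 [Z3 [def_Z _ _ _ _]]]]]]].
have uZ : uniq Z by case/andP: (simple_in_catl simZ).
case/lastP: Z lZ uZ def_Z {simZ} => [|Zb x]; first by case: (Z1 ++ K1) => [|? ?]; case: Z1 => //; case: K1.
by rewrite last_rcons rcons_uniq => -> /andP[yZ _] _; exists Zb.
Qed.

(** As w is not in [A], it lies in [Z1] or is p a as the first vertex of the core. So the part of
    [Z] from w on contains the whole core; the arc runs through it backwards from p y. *)
Lemma arc_before Z y t w : lollipop_inv Z y -> w \in Z -> w \notin A ->
  index w Z < index v0 Z ->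
  arc_ok Z y t w (rev (drop (index w Z) Z ++ take t (drop y.+1 P))).
Proof.
move=> inv wZ wA lt_w; have [/andP[le_y lt_y] [lZ hZ] sZ simZ [_ coreZ]] := inv.
have [u_T TA TZ] := segment_disjoint t inv.
have s_T := sorted_segment t lt_y.
have [Z1 [K1 [K2 [Z3 [def_Z KA KN ZA Ka]]]]] := coreZ.
have uZ : uniq Z by case/andP: (simple_in_catl simZ).
have [v0L v0R LR] : [/\ v0 \notin Z1 ++ K1, v0 \notin K2 ++ Z3
    & forall z, z \in Z1 ++ K1 -> z \notin K2 ++ Z3].
  by apply: uniq_split; rewrite -catA -def_Z.
have iv0 : index v0 Z = size (Z1 ++ K1) by rewrite def_Z catA index_split.
set T := take t _ in u_T TA TZ s_T *; set D := drop (index w Z) Z.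
have def_D : exists Z1', D = Z1' ++ K1 ++ v0 :: K2 ++ Z3 /\ {subset Z1' <= Z1}.
  have wL : w \in Z1 ++ K1.
    apply: contraLR lt_w => wL; rewrite -leqNgt iv0 {1}def_Z catA index_cat (negPf wL).
    exact: leq_addr.
  rewrite /D; have [wZ1|wZ1] := boolP (w \in Z1).
    exists (drop (index w Z1) Z1); split; last by move=> x; apply: mem_drop.
    by rewrite def_Z index_cat wZ1 drop_cat index_mem wZ1.
  move: wL; rewrite mem_cat (negPf wZ1) /= => wK1.
  have wpa : w = p a.
    by apply/eqP; move: (KA w); rewrite mem_cat wK1 mem_Aa (negPf wA) => /(_ isT).
  case: Ka => -[K' def_K]; last first.
    have := LR w; rewrite !mem_cat wK1 orbT => /(_ isT).
    by rewrite def_K wpa mem_rcons mem_head.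
  exists [::]; split=> //; rewrite def_Z def_K -wpa index_split //.
  by rewrite drop_size_cat.
have u_D : uniq D by apply: drop_uniq.
have DZ x : x \in D -> x \in Z by apply: mem_drop.
have lt_wZ : index w Z < size Z by rewrite index_mem.
have last_D : last 0 D = p y by rewrite last_drop.
have head_D : head 0 D = w by rewrite -nth0 nth_drop addn0 nth_index.
have D0 : D != [::] by rewrite -size_eq0 size_drop subn_eq0 -ltnNge.
have [D' def_D'] : exists D', D = rcons D' (p y).
  by case/lastP: (D) D0 last_D => // D' x _; rewrite last_rcons => ->; exists D'.
split.
- have uT : uniq T by case/andP: u_T.
  rewrite rev_uniq cat_uniq u_D uT andbT.
  by apply/hasPn => x /TZ; apply: contra => /DZ.
- apply: (sorted_rev e_sym); rewrite def_D'; apply: sorted_overlap => //.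
  by rewrite -def_D'; apply: drop_sorted.
- by move=> x; rewrite mem_rev !mem_cat => /orP[/DZ->|->]; rewrite ?orbT.
- by rewrite last_rev -head_D; case: (D) D0.
split; last first.
  by exists (rev D'); rewrite -rev_cat def_D' cat_rcons.
have [Z1' [def_DZ subZ1]] := def_D.
exists (rev (Z3 ++ T)), (rev K2), (rev K1), (rev Z1'); split.
- by rewrite def_DZ -!catA /= !rev_cat rev_cons !rev_cat cat_rcons -!catA.
- by move=> x; rewrite mem_cat !mem_rev orbC -mem_cat; apply: KA.
- by move=> x xP ex; rewrite mem_cat !mem_rev orbC -mem_cat; apply: KN.
- move=> x; rewrite mem_cat !mem_rev mem_cat -orbA => /or3P[xZ|/TA//|/subZ1 xZ];
    by apply: ZA; rewrite mem_cat xZ ?orbT.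
- case: Ka => -[K' def_K]; [right | left]; exists (rev K').
    by rewrite def_K rev_cons.
  by rewrite def_K rev_rcons.
Qed.

(** Here w lies in [Z3] or is p a as the last vertex of the core. From p y the arc crosses the
    closing edge to the head of [Z] and runs forward through the core to w. *)
Lemma arc_after Z y t w : lollipop_inv Z y -> w \in Z -> w != p y -> w \notin A ->
  index v0 Z <= index w Z ->
  arc_ok Z y t w (rev (take t (drop y.+1 P)) ++ last 0 Z :: take (index w Z).+1 Z).
Proof.
move=> inv wZ w_y wA le_w.
have [/andP[le_y lt_y] [lZ hZ] sZ simZ [startZ coreZ]] := inv.
have [u_T TA TZ] := segment_disjoint t inv.
have s_T := sorted_segment t lt_y.
have [Z1 [K1 [K2 [Z3 [def_Z KA KN ZA Ka]]]]] := coreZ.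
have uZ : uniq Z by case/andP: (simple_in_catl simZ).
have [v0L v0R LR] : [/\ v0 \notin Z1 ++ K1, v0 \notin K2 ++ Z3
    & forall z, z \in Z1 ++ K1 -> z \notin K2 ++ Z3].
  by apply: uniq_split; rewrite -catA -def_Z.
have iv0 : index v0 Z = size (Z1 ++ K1) by rewrite def_Z catA index_split.
have [Zb [def_Zb yZb]] := rcons_last_lollipop inv.
have wZb : w \in Zb by move: wZ; rewrite def_Zb mem_rcons inE (negPf w_y).
rewrite lZ; set T := take t _ in u_T TA TZ s_T *; set D := take (index w Z).+1 Z.
have DZ x : x \in D -> x \in Z by apply: mem_take.
have DZb : {subset D <= Zb}.
  move=> x xD; have := DZ x xD; rewrite {1}def_Zb mem_rcons inE.
  case/predU1P=> // x_y; have xZ := DZ x xD; move: xD.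
  rewrite /D in_take // x_y ltnS leqNgt.
  by rewrite def_Zb -cats1 index_split // index_cat wZb index_mem wZb.
have y_neq : y != a.
  apply: contraNneq wA => y_a; have := startZ y_a w wZ.
  by rewrite mem_Aa -y_a (negPf w_y) orbF.
have pyA : p y \notin Aa.
  by rewrite mem_take_path // -leqNgt ltn_neqAle le_y andbT eq_sym.
have def_D : exists Z3', D = Z1 ++ K1 ++ v0 :: K2 ++ Z3' /\ {subset Z3' <= Z3}.
  have wL : w \notin Z1 ++ K1.
    apply: contraL le_w => wL; rewrite -ltnNge iv0 {1}def_Z catA index_cat wL.
    by rewrite index_mem.
  have w0 : w != v0.
    apply: contraNneq wA => ->; rewrite v0E mem_take_path //.
    exact: ltn_trans a_lt.
  have wR : w \in K2 ++ Z3.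
    by move: wZ; rewrite def_Z catA mem_cat (negPf wL) inE (negPf w0).
  set L := Z1 ++ K1 ++ v0 :: K2.
  have def_ZL : Z = L ++ Z3 by rewrite def_Z /L -!catA.
  have [wZ3|wZ3] := boolP (w \in Z3).
    have wL' : w \notin L.
      by move: uZ; rewrite def_ZL cat_uniq => /and3P[_ /hasPn/(_ w wZ3)].
    exists (take (index w Z3).+1 Z3); split; last by move=> x; apply: mem_take.
    rewrite /D def_ZL index_cat (negPf wL') take_cat -addnS ltnNge leq_addr /=.
    by rewrite addKn /L -!catA.
  move: wR; rewrite mem_cat (negPf wZ3) orbF => wK2.
  have wpa : w = p a.
    by apply/eqP; move: (KA w); rewrite mem_cat wK2 orbT mem_Aa (negPf wA) => /(_ isT).
  case: Ka => -[K' def_K].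
    by move: wL; rewrite wpa def_K mem_cat mem_head orbT.
  exists [::]; split=> //; rewrite cats0 -/L /D.
  have [L' def_L] : exists L', L = rcons L' w.
    by exists (Z1 ++ K1 ++ v0 :: K'); rewrite /L def_K wpa !rcons_cat.
  have uL : uniq (rcons L' w) by move: uZ; rewrite def_ZL def_L cat_uniq => /andP[].
  rewrite def_ZL def_L cat_rcons index_split; last by move: uL; rewrite rcons_uniq => /andP[].
  by rewrite -cat_rcons -(size_rcons L' w) take_size_cat.
have u_D : uniq D by apply: take_uniq.
have lt_wZ : index w Z < size Z by rewrite index_mem.
have szD : size D = (index w Z).+1 by rewrite size_takel.
have last_D : last 0 D = w by rewrite -nth_last szD nth_take //= nth_index.
have head_D : head 0 D = p y.-1 by rewrite -nth0 nth_take // nth0.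
have yE : rev T ++ p y :: D = rev (p y :: T) ++ D by rewrite rev_cons cat_rcons.
split.
- rewrite yE cat_uniq rev_uniq u_T u_D andbT /=; apply/hasPn => x xD.
  rewrite /= mem_rev inE negb_or; apply/andP; split.
    by apply: contraNneq yZb => <-; apply: DZb.
  by apply: contraL (DZ x xD) => /TZ.
- rewrite yE; apply: sorted_cat; first exact: (sorted_rev e_sym).
    exact: take_sorted.
  move=> _ _; rewrite last_rev head_D /= e_sym.
  have y_gt0 : 0 < y by exact: leq_trans le_y.
  by have := @path_edge y.-1; rewrite prednK // => ->.
- move=> x; rewrite mem_cat mem_rev inE !mem_cat => /or3P[->|/eqP->|/DZ->]; rewrite ?orbT //.
  by rewrite def_Zb mem_rcons mem_head orbT.
- by rewrite yE last_cat -last_D; case: (D) szD.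
split; last by exists D.
have [Z3' [def_DZ subZ3]] := def_D.
exists (rev T ++ p y :: Z1), K1, K2, Z3'; split=> //.
  by rewrite def_DZ -!catA.
move=> x; rewrite !mem_cat mem_rev inE -!orbA => /or4P[/TA//|/eqP->//|xZ|/subZ3 xZ];
  by apply: ZA; rewrite mem_cat xZ ?orbT.
Qed.

Lemma lollipop_lt Z y : lollipop_inv Z y -> all (fun x => x < size M) Z.
Proof. by move=> [_ _ _ /simple_in_catl/andP[]]. Qed.

Lemma anchor_mem Z y : lollipop_inv Z y -> p a \in Z.
Proof.
move=> [_ _ _ _ [_ [Z1 [K1 [K2 [Z3 [-> _ KN _ _]]]]]]].
have := KN (p a) (mem_nth 0 a_lt) e_a; rewrite !mem_cat inE !mem_cat.
by case/orP=> ->; rewrite ?orbT.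
Qed.

(** The last vertex of [Z], where the tail is attached, is left out because ears have to avoid it.
    Vertices of [A] are sources even off the cycle, so that no ear runs through them. *)
Local Notation sources Z := (A ++ take (size Z).-1 Z).
Local Notation outside Z tl := [seq u <- vertices M | u \notin A ++ Z ++ tl].

Lemma sources_lt Z y : lollipop_inv Z y ->
  all (fun x => x < size M) (sources Z).
Proof.
move=> inv; rewrite all_cat; apply/andP; split; apply/allP => x /mem_take.
  by case/andP: P_simple => _ /allP; apply.
by apply: (allP (lollipop_lt inv)).
Qed.

Lemma outside_lt Z tl : all (fun x => x < size M) (outside Z tl).
Proof. by apply/allP => x; rewrite mem_filter mem_vertices => /andP[]. Qed.

Lemma tail_disjoint Z y x : lollipop_inv Z y -> x \in drop y.+1 P ->
  x \notin Aa /\ x \notin Z.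
Proof.
move=> inv xtl; have [_ TA TZ] := segment_disjoint (size P) inv.
by rewrite take_oversize ?size_drop ?leq_subr // in TA TZ; split; [apply: TA | apply: TZ].
Qed.

(** With p y deleted, some edge leaves the set of heads of the search table. By saturation its outer
    end can only be on the tail, which completes an ear. *)
Lemma ears_exist Z y : lollipop_inv Z y -> y.+1 < size P ->
  lollipop_ears M A Z (drop y.+1 P) != [::].
Proof.
move=> inv lt_y; have [/andP[le_y _] [lZ _] _ _ _] := inv.
set tl := drop y.+1 P.
have [[Tp TS Th _] sat] := searchP (sources_lt inv) (outside_lt Z tl).
set tb := search M _ _ in Tp TS Th sat *.
have [Zb [def_Z yZb]] := rcons_last_lollipop inv.
have tb_tl u : u \in tl -> u \notin [seq head 0 q | q <- tb].
  move=> utl; apply/mapP => -[q q_tb def_u].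
  have [uA uZ] := tail_disjoint inv utl.
  have [r [w [def_q wS rU _ _]]] := Tp q q_tb.
  case: r def_q rU => [|x r] def_q; rewrite def_q /= in def_u *.
    move: wS; rewrite -def_u mem_cat => /orP[uA'|/mem_take uZ']; last by rewrite uZ' in uZ.
    by move: uA; rewrite mem_Aa uA'.
  rewrite -def_u => /andP[xU _].
  have : u \in outside Z tl by exact: xU.
  by rewrite mem_filter !mem_cat utl !orbT.
have src_tb u : u \in sources Z -> u \in [seq head 0 q | q <- tb].
  by move=> /TS uT; apply/mapP; exists [:: u].
have P_lt i : i < size P -> p i < size M.
  by move=> lt_i; case/andP: P_simple => _ /allP; apply; apply: mem_nth.
have lt_0 : 0 < size P by exact: leq_ltn_trans a_lt.
have lt_y' : y < size P by exact: ltnW.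
case: M2 => _ _ _ /(_ (p y) (mem [seq head 0 q | q <- tb])) [].
- exists v0; first by rewrite v0E P_lt.
  rewrite /= src_tb ?v0E; last by rewrite mem_cat mem_take_path // a_gt0.
  by rewrite nth_uniq // eq_sym -lt0n (leq_trans a_gt0).
- exists (p y.+1); first exact: P_lt.
  by rewrite /= tb_tl ?mem_drop_path // nth_uniq // gtn_eqF.
move=> x [u [/mapP[q q_tb ->] /negP u_hd _ u_y exu]].
have lt_u : u < size M by rewrite (@e_lt _ (head 0 q)) // e_sym.
have [utl|utl] := boolP (u \in tl).
  rewrite -has_filter; apply/hasP; exists (u :: q); first exact: allpairs_f.
  by rewrite /= e_sym.
case: u_hd; have [uA|uA] := boolP (u \in A); first by apply: src_tb; rewrite mem_cat uA.
have [uZ|uZ] := boolP (u \in Z).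
  apply: src_tb; rewrite mem_cat; apply/orP; right.
  rewrite def_Z size_rcons -cats1 take_size_cat //.
  by move: uZ; rewrite def_Z mem_rcons inE (negPf u_y).
apply: (sat q) => //; last by rewrite e_sym.
by rewrite mem_filter !mem_cat !negb_or uA uZ utl mem_vertices.
Qed.

Lemma earP Z y c : lollipop_inv Z y -> c \in lollipop_ears M A Z (drop y.+1 P) ->
  exists t q w, [/\ y + t.+1 < size P, index (p (y + t.+1)) (drop y.+1 P) = t,
    c = p (y + t.+1) :: rcons q w, (w \in sources Z) &
    [/\ sorted e c, uniq (rcons q w) &
       forall x, x \in q -> x \in outside Z (drop y.+1 P)]].
Proof.
move=> inv; rewrite mem_filter => /andP[ec /allpairsP[[z q'] [/= ztl q_tb def_c]]].
have [[Tp _ _ _] _] := searchP (sources_lt inv) (outside_lt Z (drop y.+1 P)).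
have [q [w [def_q wS qU /andP[uq _] sq]]] := Tp _ q_tb.
pose t := index z (drop y.+1 P).
have lt_t : t < size (drop y.+1 P) by rewrite index_mem.
have def_z : z = p (y + t.+1) by rewrite addnS -addSn -nth_drop nth_index.
exists t, q, w; split.
- by move: lt_t; rewrite size_drop; alia.
- by rewrite -def_z.
- by rewrite def_c def_q def_z.
- by [].
split.
- by move: ec sq; rewrite def_c def_q /=; case: (rcons q w) => //= x s -> ->.
- by rewrite -def_q.
- by move=> x; apply/allP.
Qed.

(** The last clause records that the new cycle starts with the absorbed part of [P] read backwards;
    in the end this locates the first neighbour of vm on it. *)
Lemma lollipop_stepP Z y : lollipop_inv Z y -> y.+1 < size P ->
  exists t Z', [/\ y + t.+1 < size P,
    lollipop_step M P (Z, drop y.+1 P) = (Z', drop (y + t.+1).+1 P),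
    lollipop_inv Z' (y + t.+1) &
    exists R, Z' = rev (p y :: take t (drop y.+1 P)) ++ R].
Proof.
move=> inv lt_y; have := ears_exist inv lt_y.
rewrite /lollipop_step -aE /=; set l := lollipop_ears _ _ _ _.
case def_l: l => [//|c l'] _ /=.
have: c \in l by rewrite def_l mem_head.
move=> /(earP inv)[t [q [w [lt_t it def_c wS [sc uc qU]]]]].
set z := p (y + t.+1) in it def_c; set tl := drop y.+1 P in it qU *.
have [/andP[le_y lt_y'] [lZ hZ] sZ simZ _] := inv.
pose E := rcons (rev q) z.
have revc : rev c = w :: E by rewrite def_c rev_cons rev_rcons.
have ztl : z \in tl by rewrite mem_drop_path //; alia.
have qP x : x \in q -> [/\ x < size M, x \notin A, x \notin Z & x \notin tl].
  move=> /qU; rewrite mem_filter !mem_cat !negb_or mem_vertices.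
  by case/andP=> /and3P[-> -> ->] ->.
have [zA zZ] := tail_disjoint inv ztl.
have simE : simple_in M E.
  rewrite /simple_in /E rcons_uniq all_rcons rev_uniq mem_rev all_rev.
  move: uc; rewrite rcons_uniq => /andP[_ ->]; rewrite andbT.
  apply/and3P; split.
  - by apply: contraL ztl => /qP[].
  - by case/andP: P_simple => _ /allP; apply; apply: mem_nth.
  - by apply/allP => x /qP[].
have sE : sorted e (w :: E) by rewrite -revc; apply: sorted_rev.
have E0 : E != [::] by rewrite -size_eq0 size_rcons.
have lE : last 0 E = z by rewrite last_rcons.
have hE : e w (head 0 E) by move: sE E0; case: (E) => //= x s /andP[].
have EA x : x \in E -> x \notin Aa ++ Z.
  rewrite mem_rcons inE mem_rev mem_cat negb_or => /predU1P[->|/qP[_ xA xZ _]].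
    by rewrite zA.
  rewrite mem_Aa negb_or xA xZ /= andbT.
  by apply: contraNneq xZ => ->; apply: anchor_mem inv.
have Etl x : x \in E -> x \in tl -> x = z.
  by rewrite mem_rcons inE mem_rev => /predU1P[->//|/qP[_ _ _ /negP]].
have szA : size A = a by rewrite size_takel // ltnW.
have [Y arcY addY] : exists2 Y, arc_ok Z y t w Y & add_ear M P A Z tl c = Y ++ E.
  rewrite /add_ear revc def_c /= last_rcons it szA.
  have [wA|wA] := boolP (w \in A).
    have lt_w : index w P < a by rewrite -in_take // (mem_take wA).
    have wP : w \in P by apply: mem_take wA.
    have := arc_restart t inv lt_w; rewrite nth_index // => arcY.
    by eexists; [exact: arcY | by []].
  move: wS; rewrite mem_cat (negPf wA) /=.
  have [Zb [def_Z yZb]] := rcons_last_lollipop inv.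
  rewrite {1 2}def_Z size_rcons -cats1 take_size_cat // => wZb.
  have wZ : w \in Z by rewrite def_Z mem_rcons inE wZb orbT.
  case: ltnP => le_w; first by eexists; [exact: arc_before inv wZ wA le_w | by []].
  eexists; last by [].
  apply: arc_after inv wZ _ wA le_w.
  by apply: contraNneq yZb => <-.
have [uY sY YA lY [coreY [R def_Y]]] := arcY.
have inv' : lollipop_inv (Y ++ E) (y + t.+1).
  apply: (lollipop_extend inv lt_t simE _ E0 lE EA Etl uY sY YA _ coreY).
  - exact: path_sorted sE.
  - by rewrite lY.
  - by exists R.
exists t, (Y ++ E); split=> //; last by exists (R ++ E); rewrite def_Y catA.
rewrite /lollipop_along def_c /= -def_c addY it drop_drop.
rewrite (_ : t.+1 + y.+1 = (y + t.+1).+1); last by alia.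
by rewrite /guard_lollipop /= ifT //; case: inv'.
Qed.

End Lollipop.

(** * A cycle through both neighbourhoods when no pair crosses *)

Section Bondy.
Variable M : matrix.
Hypothesis M2 : two_connected M.
Local Notation e := (edge M).

Let e_sym : symmetric e. Proof. by case: M2. Qed.
Let e_irr : irreflexive e. Proof. by case: M2. Qed.

Variables (P : seq nat).
Local Notation v0 := (head 0 P).
Local Notation vm := (last 0 P).
Local Notation p := (nth 0 P).
Local Notation a := (last_nbr M P).
Local Notation b := (find (e vm) P).
Hypothesis P_simple : simple_in M P.
Hypothesis P_sorted : sorted e P.
Hypothesis v0_nbr : has (e v0) P.
Hypothesis vm_nbr : has (e vm) P.
Hypothesis no_crossing :
  forall i j, i < j < size P -> e v0 (p j) -> ~~ e vm (p i).

Let P_uniq : uniq P. Proof. by case/andP: P_simple. Qed.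
Let lna := last_nbr_facts M2 (erefl a) v0_nbr.
Let a_gt0 : 0 < a. Proof. by have [/andP[]] := lna. Qed.
Let a_lt : a < size P. Proof. by have [/andP[]] := lna. Qed.
Let e_a : e v0 (p a). Proof. by have [] := lna. Qed.
Let v0E : v0 = p 0. Proof. by rewrite nth0. Qed.
Let vmE : vm = p (size P).-1. Proof. by rewrite nth_last. Qed.
Let e_b : e vm (p b). Proof. exact: nth_find. Qed.
Let b_lt : b < (size P).-1.
Proof.
have lt_b : b < size P by rewrite -has_find.
rewrite ltn_neqAle -ltnS prednK ?lt_b ?andbT; last by exact: leq_ltn_trans lt_b.
by apply/eqP => def_b; move: e_b; rewrite def_b vmE e_irr.
Qed.
Let b_min j : j < size P -> e vm (p j) -> b <= j.
Proof.
by move=> lt_j ej; rewrite leqNgt; apply/negP => /(before_find 0); rewrite ej.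
Qed.
Let le_ab : a <= b.
Proof.
rewrite leqNgt; apply/negP => lt_ba.
by have := no_crossing _ e_a; move/(_ b); rewrite lt_ba a_lt e_b => /(_ isT).
Qed.

Lemma initial_lollipop_inv :
  exists2 Z, initial_lollipop M P = (Z, drop a.+1 P) & lollipop_inv M P a Z a.
Proof.
have def_Aa : take a.+1 P = rcons (take a P) (p a) by rewrite (take_nth 0).
have szA : size (take a P) = a by rewrite size_takel // ltnW.
exists (rcons (rev (take a P)) (p a)).
  congr pair; rewrite /rotation def_Aa -cats1 take_size_cat // drop_size_cat //.
  by rewrite cats1.
have [A' def_A] : exists A', take a P = v0 :: A'.
  by case: (P) a_gt0 a_lt => //= x s; case: (last_nbr _ _) => //= k; exists (take k s).
have rev0 : rcons (rev (take a P)) (p a) = rev A' ++ v0 :: [:: p a].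
  by rewrite def_A rev_cons -cats1 cat_rcons.
split.
- by rewrite leqnn.
- split; first by rewrite last_rcons.
  have : last 0 (take a P) = p a.-1.
    by rewrite -nth_last szA nth_take // prednK.
  rewrite -head_rev; case def_r: (rev _) => [|x s] //=.
  by move: (congr1 size def_r); rewrite size_rev szA => a0; move: a_gt0; rewrite a0.
- rewrite -cats1; apply: sorted_cat => //.
    exact/(sorted_rev e_sym)/take_sorted.
  by move=> _ _; rewrite last_rev -nth0 nth_take // nth0.
- rewrite (@simple_in_perm M _ P) // -[P in perm_eq _ P](cat_take_drop a.+1 P) def_Aa.
  by rewrite perm_cat2r -!cats1 perm_cat2r perm_rev.
split; first by move=> _ x; rewrite def_Aa !mem_rcons !inE mem_rev.
(* Initially the core is the whole cycle: the head of [P] read backwards to [v0], then p a. *)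
exists [::], (rev A'), [:: p a], [::]; split=> //.
- move=> x; rewrite def_Aa def_A mem_cat mem_rev mem_rcons !inE => /orP[->|->] //.
  by rewrite !orbT.
- move=> x /(nthP 0)[j lt_j <-] ej; rewrite mem_cat mem_rev inE.
  have le_ja : j <= a.
    rewrite leqNgt; apply/negP => lt_aj; have [_ _ /(_ j)] := lna.
    by rewrite lt_aj lt_j ej => /(_ isT).
  have : p j \in take a.+1 P by rewrite (mem_take_path P_simple).
  rewrite def_Aa def_A mem_rcons !inE => /or3P[->|/eqP ej0|->]; rewrite ?orbT //.
  by move: ej; rewrite ej0 e_irr.
- by right; exists [::].
Qed.

(** The point of attachment advances in every step, so the number of steps stays at most its index,
    within the range tried by [cycles_of_path]. The process stops at the step that jumps over b, so
    p b is on the segment just absorbed. *)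
Lemma lollipop_reaches k Z y : lollipop M P k = (Z, drop y.+1 P) ->
  lollipop_inv M P a Z y -> y <= b -> k <= y ->
  exists k' Z' y0 t, [/\ lollipop M P k' = (Z', drop (y0 + t.+1).+1 P),
    lollipop_inv M P a Z' (y0 + t.+1), y0 <= b < y0 + t.+1, k' <= y0 + t.+1 &
    exists R, Z' = rev (p y0 :: take t (drop y0.+1 P)) ++ R].
Proof.
have [m] := ubnP (size P - y); elim: m k Z y => // m IH k Z y lt_m def_k inv le_yb le_ky.
have lt_y : y.+1 < size P by move: b_lt le_yb; alia.
have [t [Z' [lt_t stepE inv' def_Z']]] :=
  lollipop_stepP M2 P_simple P_sorted (erefl a) v0_nbr inv lt_y.
have def_k' : lollipop M P k.+1 = (Z', drop (y + t.+1).+1 P).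
  by rewrite /lollipop iterS -/(lollipop M P k) def_k.
have le_k' : k.+1 <= y + t.+1 by rewrite addnS ltnS (leq_trans le_ky) // leq_addr.
have [le_b|lt_b] := leqP (y + t.+1) b; last first.
  by exists k.+1, Z', y, t; split=> //; rewrite le_yb.
by apply: IH def_k' inv' le_b le_k'; move: lt_m lt_t; alia.
Qed.

(** The path [W] begins with p (y0 + t), ..., p y0, which includes p b, and ends at vm. Closing it
    drops only vertices before the first neighbour of vm; these have index above b and are not
    adjacent to vm, so no neighbour of either end is lost. *)
Lemma lollipop_cycle : exists k, k < size P /\
  let C := close_cycle M ((lollipop M P k).1 ++ (lollipop M P k).2) in
  size (nbr_indices M P v0) + size (nbr_indices M P vm) <= size C /\
  (2 < size C -> is_cycle_of M C).
Proof.
have [Z0 def0 inv0] := initial_lollipop_inv.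
have [k [Z [y0 [t [def_k inv /andP[le_y0 lt_b] le_k [R def_Z]]]]]] :=
  lollipop_reaches (k := 0) def0 inv0 le_ab (leq0n _).
have [/andP[_ lt_y] [lZ hZ] sZ simZ [_ coreZ]] := inv.
exists k; split; first exact: leq_ltn_trans le_k lt_y.
rewrite def_k /=; set y := y0 + t.+1 in inv lt_y lt_b simZ lZ hZ *; set W := Z ++ _.
have lt0 : 0 < size P by exact: leq_ltn_trans a_lt.
have Z_neq0 : Z != [::] by rewrite def_Z rev_cons -cats1; case: (rev _).
have lastW : last 0 W = vm.
  rewrite last_cat lZ; have [ge_y|lt_yS] := leqP (size P) y.+1.
    by rewrite drop_oversize //= vmE; congr nth; alia.
  rewrite -(last_drop lt_yS); case def_d: (drop _ _) => [|x s] //.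
  by move: (congr1 size def_d); rewrite size_drop => /eqP; rewrite subn_eq0 leqNgt lt_yS.
have sW : sorted e W.
  apply: sorted_cat => //; first exact: drop_sorted.
  move=> _ d0; rewrite lZ -nth0 nth_drop addn0; apply: (path_edge P_sorted) => //.
  by move: d0; rewrite -size_eq0 size_drop subn_eq0 -ltnNge.
set seg := p y0 :: _ in def_Z.
have lt_y0 : y0 < size P by move: lt_y; rewrite /y; alia.
have segE : seg = drop y0 (take y P) by rewrite /seg segment_cons.
have sz_seg : size seg = t.+1 by rewrite segE size_drop size_takel ?(ltnW lt_y) // addKn.
have nthW j : j <= t -> nth 0 W j = p (y0 + t - j).
  move=> le_j; rewrite /W def_Z -catA nth_cat size_rev sz_seg ltnS le_j.
  rewrite nth_rev ?sz_seg // segE nth_drop nth_take; last by rewrite /y; alia.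
  by congr nth; alia.
have szW : t < size W by rewrite /W def_Z -catA size_cat size_rev sz_seg; alia.
have le_jb : y0 + t - b <= t by alia.
have nth_b : nth 0 W (y0 + t - b) = p b.
  by rewrite nthW // subKn //; move: lt_b; rewrite /y; alia.
have hW : has (e (last 0 W)) W.
  apply/(has_nthP 0); exists (y0 + t - b); first exact: leq_ltn_trans szW.
  by rewrite lastW nth_b.
set C := close_cycle M W.
have def_C : C = drop (find (e vm) W) W by rewrite /C /close_cycle lastW.
set f := find _ _ in def_C.
have lt_f : f < size W by rewrite -has_find -lastW.
have le_f : f <= y0 + t - b.
  rewrite leqNgt; apply/negP => /(before_find 0); by rewrite nth_b e_b.
have inC j : j < size P -> p j \in W -> (j <= b) || e vm (p j) -> p j \in C.
  move=> lt_j; rewrite -{1}(cat_take_drop f W) -def_C mem_cat => /orP[|//].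
  move=> /(nthP 0)[i]; rewrite size_takel ?(ltnW lt_f) // => lt_i.
  rewrite nth_take // => def_j; have := before_find 0 lt_i.
  rewrite def_j => -> /=; rewrite orbF => le_j.
  have le_it : i <= t by apply: leq_trans (ltnW lt_i) (leq_trans le_f le_jb).
  have /eqP := nthW i le_it; rewrite def_j nth_uniq //; last by move: lt_y; rewrite /y; alia.
  by move=> /eqP; alia.
have last_C : vm \in C.
  have -> : vm = last 0 C by rewrite def_C last_drop.
  by rewrite -nth_last mem_nth // def_C size_drop; alia.
split; last first.
  by move=> gt2; apply: close_cycle_is_cycle.
(* Since a <= b, the only possible common neighbour of the two ends is p a; it is counted once, and
   vm fills the gap. *)
pose L := nbr_indices M P v0 ++ [seq j <- nbr_indices M P vm | j != a] ++ [:: (size P).-1].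
have L_lt j : j \in L -> j < size P.
  rewrite !mem_cat mem_filter !mem_nbr_indices inE.
  by case/or3P => [/andP[]//|/and3P[]//|/eqP->]; rewrite ltn_predL.
have N0_le j : j \in nbr_indices M P v0 -> j <= a.
  rewrite mem_nbr_indices => /andP[lt_j ej]; rewrite leqNgt; apply/negP => lt_aj.
  by have [_ _ /(_ j)] := lna; rewrite lt_aj lt_j ej => /(_ isT).
have uL : uniq L.
  rewrite !cat_uniq !filter_uniq ?iota_uniq //= !andbT; apply/andP; split.
    apply/hasPn => j; rewrite mem_cat mem_filter inE => jL; apply/negP => /N0_le le_j.
    case/orP: jL => [/andP[j_a]|/eqP def_j]; last first.
      by move: le_j b_lt le_ab; rewrite def_j; alia.
    rewrite mem_nbr_indices => /andP[lt_j /(b_min lt_j) le_bj].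
    by move: j_a; rewrite eqn_leq le_j (leq_trans le_ab).
  rewrite orbF mem_filter mem_nbr_indices -vmE e_irr !andbF //.
have LC : {subset [seq p j | j <- L] <= C}.
  move=> x /mapP[j jL ->]; have lt_j := L_lt j jL; move: jL.
  rewrite !mem_cat mem_filter inE => /or3P[j0|/andP[_ jm]|/eqP->]; last by rewrite -vmE.
    apply: inC => //; last by rewrite (leq_trans (N0_le j j0)).
    move: j0; rewrite mem_nbr_indices => /andP[_ ej].
    rewrite /W mem_cat; apply/orP; left.
    have [Z1 [K1 [K2 [Z3 [-> _ KN _ _]]]]] := coreZ.
    have := KN _ (mem_nth 0 lt_j) ej; rewrite !(mem_cat, inE).
    by case/orP=> ->; rewrite ?orbT.
  move: jm; rewrite mem_nbr_indices => /andP[_ ej].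
  apply: inC => //; last by rewrite ej orbT.
  have le_bj := b_min lt_j ej.
  rewrite mem_cat (mem_drop_path P_simple) //; case: (ltngtP j y) => [lt_jy|_|->]; rewrite ?orbT //.
    apply/orP; left; rewrite def_Z mem_cat mem_rev segE; apply/orP; left.
    apply/(nthP 0); exists (j - y0).
      by rewrite size_drop size_takel ?(ltnW lt_y) //; move: le_y0 lt_jy; alia.
    by rewrite nth_drop subnKC ?nth_take // (leq_trans le_y0).
  by rewrite -lZ -nth_last mem_nth // ltn_predL lt0n size_eq0.
have le_L : size L <= size C.
  rewrite -(size_map p); apply: uniq_leq_size => //.
  rewrite map_inj_in_uniq // => i j /L_lt lt_i /L_lt lt_j /eqP.
  by rewrite nth_uniq // => /eqP.
apply: leq_trans le_L; rewrite /L !size_cat leq_add2l addn1.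
have uN : uniq (nbr_indices M P vm) by rewrite filter_uniq // iota_uniq.
rewrite -(count_predC (pred1 a) (nbr_indices M P vm)) count_uniq_mem // size_filter.
by rewrite -add1n leq_add // leq_b1.
Qed.

End Bondy.

Lemma optimal_path_long_cycle (M : matrix) (bv : seq bool) (P : seq nat) (d : nat) :
  two_connected M -> locally_optimal M bv P ->
  (exists2 v, v < size M & ~~ nth false bv v) ->
  (forall v, v < size M -> ~~ nth false bv v ->
     d <= count (fun u => edge M v u && ~~ nth false bv u) (vertices M)) ->
  1 < d ->
  exists2 C, C \in cycles_of_path M P &
    minn (count (fun v => ~~ nth false bv v) (vertices M)) (d + d) <= size C.
Proof.
move=> M2 optP ex_v deg_d d_gt1.
have sP := optimal_path_simple optP; have lP := optimal_path_sorted optP.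
have le0 := d_le_head M2 optP ex_v deg_d; have lem := d_le_last M2 optP ex_v deg_d.
pose cross i j := [&& i < j, edge M (head 0 P) (nth 0 P j) & edge M (last 0 P) (nth 0 P i)].
have [|nocross] := boolP (has (fun i => has (cross i) (iota 0 (size P))) (iota 0 (size P))).
  case/hasP => i _ /hasP[j]; rewrite mem_iota add0n => /andP[_ lt_j] /and3P[lt_ij ej ei].
  by apply: (crossing_cycle M2 optP ex_v deg_d d_gt1 (i0 := i) (j0 := j)); rewrite ?lt_ij.
have nbr v : d <= size (nbr_indices M P v) -> has (edge M v) P.
  by rewrite size_nbr_indices has_count; apply: leq_trans (ltnW d_gt1).
have nc i j : i < j < size P -> edge M (head 0 P) (nth 0 P j) ->
    ~~ edge M (last 0 P) (nth 0 P i).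
  move=> /andP[lt_ij lt_j] ej; apply: contra nocross => ei.
  apply/hasP; exists i; first by rewrite mem_iota (ltn_trans lt_ij).
  by apply/hasP; exists j; rewrite ?mem_iota // /cross lt_ij ej.
have [k [lt_k]] := lollipop_cycle M2 sP lP (nbr _ le0) (nbr _ lem) nc.
set C := close_cycle M _ => -[le_C cycC].
have le_dC : d + d <= size C by apply: leq_trans le_C; apply: leq_add.
exists C; last by rewrite geq_min le_dC orbT.
rewrite mem_filter cycC; last by move: d_gt1 le_dC; clear; lia.
rewrite mem_cat; apply/orP; right; apply/mapP; exists k => //.
by rewrite mem_vertices (leq_trans lt_k) // simple_in_size.
Qed.

Lemma longest_max cs c : c \in cs -> size c <= size (longest cs).
Proof.
elim: cs => //= c' cs IH; rewrite inE => /predU1P[->|/IH le_c]; case: ltnP => //.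
by move=> lt_c; exact: leq_trans le_c (ltnW lt_c).
Qed.

Lemma longest_catl cs1 cs2 c : c \in cs1 -> size c <= size (longest (cs1 ++ cs2)).
Proof. by move=> c1; apply: longest_max; rewrite mem_cat c1. Qed.

Lemma longest_catr cs1 cs2 c : c \in cs2 -> size c <= size (longest (cs1 ++ cs2)).
Proof. by move=> c2; apply: longest_max; rewrite mem_cat c2 orbT. Qed.

Lemma longest_mem cs : longest cs != [::] -> longest cs \in cs.
Proof.
elim: cs => //= c' cs IH; case: ltnP => _; first by rewrite mem_head.
by move=> /IH; rewrite inE orbC => ->.
Qed.

Lemma exists_third n u v : 2 < n -> exists2 y, y < n & (y != u) && (y != v).
Proof.
move=> n2; have : 0 < size [seq y <- iota 0 n | (y != u) && (y != v)].
  have : size (iota 0 n) <= size (u :: v :: [seq y <- iota 0 n | (y != u) && (y != v)]).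
    apply: uniq_leq_size; first exact: iota_uniq.
    by move=> y yn; rewrite !inE mem_filter yn; case: eqP; case: eqP.
  by rewrite size_iota /=; lia.
case def_l: [seq _ <- _ | _] => [//|y l] _.
have: y \in y :: l by rewrite mem_head.
by rewrite -def_l mem_filter mem_iota => /andP[yuv /andP[_ lt_y]]; exists y.
Qed.

(** The cut around the single vertex [v] gives a neighbour, and after deleting this neighbour it
    gives another one. *)
Lemma two_connected_degree (M : matrix) v : two_connected M -> 2 < size M -> v < size M ->
  1 < count (edge M v) (vertices M).
Proof.
move=> [e_sym e_irr e_lt conn] n2 lt_v.
have ex_nbr r : r != v -> exists2 u, edge M v u & u != r.
  move=> r_v; case: (conn r (pred1 v)).
  - by exists v => //=; rewrite eqxx eq_sym.
  - by have [y lt_y /andP[yv yr]] := exists_third v r n2; exists y => //=; rewrite yv.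
  - by move=> x [u [/eqP-> _ _ ur evu]]; exists u.
have [u evu _] := ex_nbr (size M) (negbT (gtn_eqF lt_v)).
have uv : u != v by apply: contraTneq evu => ->; rewrite e_irr.
have [w evw wu] := ex_nbr u uv.
rewrite -size_filter (@leq_trans (size [:: u; w])) //; apply: uniq_leq_size.
  by rewrite /= inE eq_sym wu.
by move=> x; rewrite !inE mem_filter mem_vertices => /orP[] /eqP->;
  rewrite ?evu ?evw (e_lt _ v) // e_sym.
Qed.

Lemma cycles_of_pathP (M : matrix) P C : C \in cycles_of_path M P -> is_cycle_of M C.
Proof. by rewrite mem_filter => /andP[]. Qed.

Lemma long_cycleP (M : matrix) (bv : seq bool) (d : nat) :
  two_connected M -> 2 < size M ->
  (forall v, v < size M -> ~~ nth false bv v ->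
     d <= count (fun u => edge M v u && ~~ nth false bv u) (vertices M)) ->
  (1 < d -> exists2 v, v < size M & ~~ nth false bv v) ->
  is_cycle_of M (long_cycle M bv) /\
  minn (count (fun v => ~~ nth false bv v) (vertices M)) (d + d) <= size (long_cycle M bv).
Proof.
move=> M2 n2 deg_d ex_v; rewrite /long_cycle; set cs := _ ++ _.
have nB v : ~~ nth false [::] v by rewrite nth_nil.
have lt0 : 0 < size M by apply: leq_trans n2.
(* With no vertex in B all degrees are at least 2, so this run always finds a cycle, of length at
   least min(n, 4) > 2. *)
have [C0 C0P le_C0] : exists2 C, C \in cycles_of_path M (optimal_path M [::]) &
    minn (count (fun v => ~~ nth false [::] v) (vertices M)) (2 + 2) <= size C.
  apply: (optimal_path_long_cycle (bv := [::]) M2) => //.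
  - exact: optimal_path_ok lt0 (nB 0).
  - by exists 0.
  - move=> v lt_v _; apply: leq_trans (two_connected_degree M2 n2 lt_v) _.
    by apply: sub_count => u /= ->; exact: nB.
have gt2 : 2 < size (longest cs).
  apply: (@leq_trans (size C0)); last exact: longest_catr C0P.
  apply: leq_trans le_C0; rewrite leq_min andbT.
  rewrite (eq_count (a2 := predT)) ?count_predT ?size_iota //.
have cs_in : longest cs \in cs.
  by apply: longest_mem; rewrite -size_eq0; case: (size _) gt2.
split; first by move: cs_in; rewrite mem_cat => /orP[/cycles_of_pathP|/cycles_of_pathP].
(* For d at most 1 the required length is at most 2, less than that of any cycle. *)
have [d_gt1|d_le1] := ltnP 1 d; last first.
  by rewrite geq_min; apply/orP; right; move: gt2 d_le1; clear; lia.
have [v lt_v vB] := ex_v d_gt1.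
have [C CP le_C] := optimal_path_long_cycle M2 (optimal_path_ok lt_v vB) (ex_v d_gt1) deg_d d_gt1.
by apply: leq_trans le_C _; exact: longest_catl CP.
Qed.

Lemma path_leaves (T : Type) (r : rel T) (S : pred T) x s :
  path r x s -> S x -> ~~ S (last x s) -> exists y z, [/\ S y, ~~ S z & r y z].
Proof.
elim: s x => [|z s IH] x /=; first by move=> _ ->.
case/andP=> rxz rs Sx nS; have [Sz|nSz] := boolP (S z); first exact: IH nS.
by exists x, z.
Qed.

(** * From graphs to adjacency matrices *)

Section Graph.
Variables (G : sgraph) (B : {set G}).
Hypothesis G2 : k_connected 2 G.

Definition adj_matrix : matrix := [seq [seq adj x y | y <- enum G] | x <- enum G].
Definition char_vector : seq bool := [seq x \in B | x <- enum G].

Let n2 : 2 < #|G|. Proof. by case: G2. Qed.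
Let x0 : G. Proof. by case: (pickP (mem G)) => [x //|/eq_card0 G0]; move: n2; rewrite G0. Qed.
Local Notation vtx := (nth x0 (enum G)).
Local Notation rank x := (nat_of_ord (@enum_rank (vertex G) x)).

Let size_enum : size (enum G) = #|G|. Proof. by rewrite -cardE. Qed.
Let rankK x : vtx (rank x) = x. Proof. exact: nth_enum_rank. Qed.
Let rank_lt x : rank x < #|G|. Proof. exact: ltn_ord. Qed.
Let vtxK i : i < #|G| -> rank (vtx i) = i.
Proof.
move=> lt_i; have -> : vtx i = enum_val (Ordinal lt_i) by rewrite (enum_val_nth x0).
by rewrite enum_valK.
Qed.
Let rank_inj : injective (fun x : G => rank x).
Proof. by move=> x y /= xy; rewrite -(rankK x) xy rankK. Qed.

Lemma size_adj_matrix : size adj_matrix = #|G|.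
Proof. by rewrite size_map -cardE. Qed.

Lemma edge_adj_matrix i j : edge adj_matrix i j =
  [&& i < #|G|, j < #|G| & adj (vtx i) (vtx j)].
Proof.
rewrite /edge; have [lt_i|ge_i] := ltnP i #|G|; last first.
  by rewrite (nth_default _ (_ : size adj_matrix <= i)) ?size_adj_matrix ?nth_nil.
rewrite (nth_map x0) ?size_enum //; have [lt_j|ge_j] := ltnP j #|G|; last first.
  by rewrite nth_default // size_map -cardE.
by rewrite (nth_map x0) // -cardE.
Qed.

Lemma nth_char_vector i : i < #|G| -> nth false char_vector i = (vtx i \in B).
Proof. by move=> lt_i; rewrite (nth_map x0) ?size_enum. Qed.

Lemma adj_matrix_two_connected : two_connected adj_matrix.
Proof.
split.
- by move=> i j; rewrite !edge_adj_matrix adj_sym andbCA.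
- by move=> i; rewrite edge_adj_matrix adj_irrefl !andbF.
- by move=> i j; rewrite edge_adj_matrix size_adj_matrix => /andP[].
rewrite size_adj_matrix => v S [x lt_x /andP[Sx xv]] [y lt_y /andP[Sy yv]].
(* A number [v] beyond the vertices deletes nothing; in both cases fewer than two vertices are
   deleted. *)
pose X := if v < #|G| then [set vtx v] else set0.
have X2 : #|X| < 2 by rewrite /X; case: ifP; rewrite ?cards1 ?cards0.
have out z : z < #|G| -> z != v -> vtx z \notin X.
  rewrite /X => lt_z zv; case: ifP => [lt_v|]; rewrite ?inE //.
  by rewrite nth_uniq ?size_enum // enum_uniq.
have [_ [_ /(_ X X2)[_ conn]]] := (I, G2).
pose x' : delete X := exist _ (vtx x) (out x lt_x xv).
pose y' : delete X := exist _ (vtx y) (out y lt_y yv).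
have /connectP[s ps def_y] := conn x' y'.
have [||z [w [Sz Sw zw]]] := path_leaves (S := fun z : delete X => S (rank (val z))) ps.
- by rewrite /= vtxK.
- by rewrite -def_y /= vtxK.
have out' (u : delete X) : rank (val u) != v.
  have vX : v < #|G| -> vtx v \in X by move=> lt_v; rewrite /X lt_v inE.
  apply: contraNneq (valP u) => u_v.
  have -> : val u = vtx v by rewrite -u_v rankK.
  by apply: vX; rewrite -u_v.
exists (rank (val z)), (rank (val w)); split=> //.
by rewrite edge_adj_matrix !rank_lt !rankK.
Qed.

Lemma min_degree_le (H : sgraph) (v : H) : min_degree H <= degree v.
Proof.
rewrite /min_degree; have: v \in index_enum H by apply: mem_index_enum.
elim: (index_enum _) => // u s IH; rewrite inE big_cons geq_min => /predU1P[->|/IH->].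
  by rewrite leqnn.
by rewrite orbT.
Qed.

Lemma min_degree_delete_count v : v < #|G| -> ~~ nth false char_vector v ->
  min_degree (delete B) <=
    count (fun u => edge adj_matrix v u && ~~ nth false char_vector u)
      (vertices adj_matrix).
Proof.
move=> lt_v; rewrite nth_char_vector // => vB.
apply: leq_trans (min_degree_le (exist _ (vtx v) vB : delete B)) _.
rewrite /degree cardE -size_filter -(size_map (fun u => rank (val u))).
apply: uniq_leq_size.
  rewrite map_inj_uniq ?enum_uniq // => x y xy; apply/val_inj/rank_inj; exact: xy.
move=> _ /mapP[u u_in ->]; move: u_in; rewrite mem_enum inE => vu.
rewrite mem_filter mem_vertices size_adj_matrix rank_lt andbT.
rewrite edge_adj_matrix lt_v rank_lt nth_char_vector // rankK /=.
by apply/andP; split; [exact: vu | exact: (valP u)].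
Qed.

Lemma card_outside :
  #|G| - #|B| <= count (fun v => ~~ nth false char_vector v) (vertices adj_matrix).
Proof.
rewrite -(cardsC B) addKn cardE -size_filter -(size_map (fun u => rank u)).
apply: uniq_leq_size.
  by rewrite map_inj_uniq ?enum_uniq.
move=> x /mapP[u]; rewrite mem_enum inE => uB ->.
by rewrite mem_filter mem_vertices size_adj_matrix rank_lt nth_char_vector ?rankK ?uB.
Qed.

(** The graph without vertices has minimum degree 0, so here G - B is not empty. *)
Lemma min_degree_gt0_ex : 1 < min_degree (delete B) ->
  exists2 v, v < size adj_matrix & ~~ nth false char_vector v.
Proof.
move=> d1; have [v _|noV] := pickP (mem (delete B)).
  exists (rank (val v)); first by rewrite size_adj_matrix.
  by rewrite nth_char_vector // rankK; exact: (valP v).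
by move: d1; rewrite /min_degree big_pred0 // (eq_card0 noV).
Qed.

Lemma long_cycle_graph : exists C : seq G,
  [/\ [seq rank x | x <- C] = long_cycle adj_matrix char_vector, is_cycle C &
      minn (#|G| - #|B|) (2 * min_degree (delete B)) <= size C].
Proof.
have [cycC le_C] : is_cycle_of adj_matrix (long_cycle adj_matrix char_vector) /\
    minn (count (fun v => ~~ nth false char_vector v) (vertices adj_matrix))
      (min_degree (delete B) + min_degree (delete B))
      <= size (long_cycle adj_matrix char_vector).
  apply: long_cycleP.
  - exact: adj_matrix_two_connected.
  - by rewrite size_adj_matrix.
  - move=> v; rewrite size_adj_matrix; exact: min_degree_delete_count.
  - exact: min_degree_gt0_ex.
move: cycC le_C; set c := long_cycle _ _ => /and3P[/andP[uc ltc] sc c2] le_C.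
have lt_c x : x \in c -> x < #|G| by move/(allP ltc); rewrite size_adj_matrix.
exists [seq vtx i | i <- c]; split.
- by rewrite -map_comp map_id_in // => x /lt_c/vtxK.
- split; last by rewrite size_map.
  apply/andP; split; last first.
    rewrite map_inj_in_uniq // => x y /lt_c lt_x /lt_c lt_y xy.
    by rewrite -(vtxK lt_x) xy vtxK.
  case: c sc {uc ltc c2 le_C lt_c} => //= x s; rewrite -map_rcons path_map.
  by apply: sub_path => y z; rewrite edge_adj_matrix => /and3P[].
rewrite size_map; apply: leq_trans le_C.
rewrite leq_min geq_min card_outside /= geq_min.
by rewrite mul2n -addnn leqnn orbT.
Qed.

End Graph.

Lemma esize_input (G : sgraph) (B : {set G}) :
  esize (adj_matrix G, char_vector B) <= 40 * #|G|.+1 ^ 2.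
Proof.
have le_bool (s : seq bool) : esize s <= 4 * size s + 1.
  elim: s => // b s IH; rewrite esize_cons /=.
  have : esize b <= 3 by case: b.
  lia.
have le_rows (l : seq (seq bool)) n : all (fun s => size s <= n) l ->
    esize l <= size l * (4 * n + 2) + 1.
  elim: l => //= s l IH /andP[le_s /IH le_l]; rewrite esize_cons.
  pose proof (le_bool s); lia.
rewrite esize_pair.
have le_v := le_bool (char_vector B).
have le_m : esize (adj_matrix G) <= size (adj_matrix G) * (4 * #|G| + 2) + 1.
  by apply: le_rows; apply/allP => _ /mapP[x _ ->]; rewrite size_map -cardE.
have szv : size (char_vector B) = #|G| by rewrite size_map -cardE.
rewrite szv in le_v; rewrite size_adj_matrix in le_m.
rewrite expnS expn1; nia.
Qed.

Theorem theorem17 :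
  (forall (G : sgraph) (B : {set G}), k_connected 2 G ->
     exists C : seq G,
       is_cycle C /\
       minn (#|G| - #|B|) (2 * min_degree (delete B)) <= size C) /\
  (exists p : program,
     polytime_constructs
       (fun (G : sgraph) (B : {set G}) => k_connected 2 G)
       (fun (G : sgraph) (B : {set G}) (C : seq G) =>
          is_cycle C /\
          minn (#|G| - #|B|) (2 * min_degree (delete B)) <= size C)
       p).
Proof.
split.
  by move=> G B /(long_cycle_graph B)[C [_ cC le_C]]; exists C.
have [q [i [lt_i [c [k H]]]]] := polytime_long_cycle.
(* Execution starts with function 0, so a new first function calls the compiled one, whose number is
   shifted by one. *)
exists (ECall i.+1 (EVar 0) :: [seq relocate (size q) 1 f | f <- q]).
(* The code of the input has size at most 40 (n + 1)^2, which doubles the exponent; the summand 3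
   covers the two extra steps of the first call. *)
exists (c * 40 ^ k + 3), (2 * k) => G B G2.
have [C [rankC cC le_C]] := long_cycle_graph B G2.
have [t [E le_t _]] := H (adj_matrix G, char_vector B).
exists C, (1 + t).+1; split=> //.
- apply: eval_call; first exact: (eval_var _ [:: enc_input B] 0).
  rewrite /= (nth_map ELeaf) //.
  have -> : enc_vertices C = enc (long_cycle (adj_matrix G) (char_vector B)).
    by rewrite -rankC /enc_vertices; elim: (C) => //= x s ->.
  apply: eval_relocate E => j lt_j.
  by rewrite addn1 /= (nth_map ELeaf).
- have le_s : esize (adj_matrix G, char_vector B) ^ k <= (40 * #|G|.+1 ^ 2) ^ k.
    by case: k {H le_t} => // k; rewrite leq_exp2r // esize_input.
  have : c * esize (adj_matrix G, char_vector B) ^ k <= c * 40 ^ k * #|G|.+1 ^ (2 * k).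
    by rewrite -mulnA expnM -expnMn leq_mul2l le_s orbT.
  have := expn_gt0 #|G|.+1 (2 * k); rewrite /= mulnDl.
  move: le_t; set m := _ ^ (2 * k); set u := c * _ ^ k * m; lia.
Qed.
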